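(* Let $m,n$ be positive integers, let $S$ be a positive definite symmetric integral $m\times m$ matrix and let $\Omega\in\mathbb H_n$. Let $R_S^{\Omega}$ be the complex vector space of all holomorphic functions $f:\mathbb C^{(m,n)}\to\mathbb C$ satisfying $$f(W+\xi\Omega+\eta)=e^{-\pi i\,\sigma\{S(\xi\Omega\,{}^t\xi+2\,\xi\,{}^tW)\}}f(W)\qquad (W\in\mathbb C^{(m,n)},\ \xi,\eta\in\mathbb Z^{(m,n)}).$$ Let $\mathcal A_{S,\Omega}$ be the complex vector space of all smooth functions $\varphi:H_{\mathbb R}^{(n,m)}\to\mathbb C$ satisfying (a) $\varphi([\xi,\eta,0]\diamond g_0)=\varphi(g_0)$ for all $\xi,\eta\in\mathbb Z^{(m,n)}$ and $g_0\in H_{\mathbb R}^{(n,m)}$; (b) $\varphi(g_0\diamond[0,0,\kappa])=e^{\pi i\,\sigma(S\kappa)}\varphi(g_0)$ for all $\kappa={}^t\kappa\in\mathbb R^{(m,m)}$ and $g_0\in H_{\mathbb R}^{(n,m)}$; (c) $\bigl(\mathcal L_{X_{ka}}-\sum_{b=1}^n\Omega_{ab}\,\mathcal L_{\widehat X_{kb}}\bigr)\varphi=0$ for all $1\le k\le m$, $1\le a\le n$. For $g_0=[\lambda,\mu,\kappa]\in H_{\mathbb R}^{(n,m)}$ put $\tilde J(g_0,0)=e^{\pi i\,\sigma\{S(\lambda\Omega\,{}^t\lambda+\kappa)\}}$ and $g_0\cdot 0=\lambda\Omega+\mu\in\mathbb C^{(m,n)}$. Then the map $$f\longmapsto \varphi_f,\qquad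 \varphi_f(g_0):=\tilde J(g_0,0)\,f(g_0\cdot 0)$$ is an isomorphism of vector spaces from $R_S^{\Omega}$ onto $\mathcal A_{S,\Omega}$. Its inverse is $\varphi\mapsto f_\varphi$, $f_\varphi(W):=\tilde J(g_0,0)^{-1}\varphi(g_0)$ where $g_0\in H_{\mathbb R}^{(n,m)}$ is any element with $W=g_0\cdot 0$; this does not depend on the choice of $g_0$.
   Context: $F^{(k,l)}$ denotes the set of $k\times l$ matrices over $F$, ${}^tM$ the transpose, $\sigma$ the trace. $\mathbb H_n$ is the Siegel upper half plane of symmetric complex $n\times n$ matrices with positive definite imaginary part. The Heisenberg group $H_{\mathbb R}^{(n,m)}$ is, in the coordinates used here, the set of triples $[\lambda,\mu,\kappa]$ with $\lambda,\mu\in\mathbb R^{(m,n)}$ and $\kappa={}^t\kappa\in\mathbb R^{(m,m)}$, with multiplication $$[\lambda,\mu,\kappa]\diamond[\lambda_0,\mu_0,\kappa_0]=[\lambda+\lambda_0,\ \mu+\mu_0,\ \kappa+\kappa_0+\lambda\,{}^t\mu_0+\mu_0\,{}^t\lambda].$$ For an element $X$ of its Lie algebra, $(\mathcal L_X\varphi)(g_0)=\frac{d}{dt}\big|_{t=0}\varphi(g_0\diamond\exp tX)$. Let $E_{ka}$ be the $m\times n$ matrix with entry $1$ in position $(k,a)$ and $0$ elsewhere; $X_{ka}$ and $\widehat X_{ka}$ are the Lie algebra elements with $\exp(tX_{ka})=[tE_{ka},0,0]$ and $\exp(t\widehat X_{ka})=[0,tE_{ka},0]$. $\Omega_{ab}$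 are the entries of $\Omega$. *)

(* Defs.v *)
From HB Require Import structures.
From mathcomp Require Import all_boot all_order all_algebra.
From mathcomp Require Import complex.
From mathcomp Require Import all_classical all_reals all_analysis.

Set Implicit Arguments.
Unset Strict Implicit.
Unset Printing Implicit Defensive.
Import Order.TTheory GRing.Theory Num.Theory.
Import numFieldNormedType.Exports.

Local Open Scope classical_set_scope.
Local Open Scope ring_scope.
Local Open Scope complex_scope.

(* The Heisenberg group is the product of two matrix spaces and the space of
   symmetric matrices; the latter is made a real normed space (with the norm
   of the ambient matrix space) so that smoothness on the group is smoothness
   on a finite-dimensional real normed space. *)
Section SymmetricMatrices.
Variables (R : realType) (m : nat).

Definition symmetric_pred : {pred 'M[R]_m} := fun K => K^T == K.

Fact symmetric_submod_closed : submod_closed symmetric_pred.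
Proof.
split=> [|a A B]; rewrite !unfold_in /=; first by rewrite trmx0.
by move=> /eqP sA /eqP sB; rewrite linearP /= sA sB.
Qed.
HB.instance Definition _ :=
  GRing.isSubmodClosed.Build R 'M[R]_m symmetric_pred symmetric_submod_closed.

Record symmx := SymMx { symmx_val :> 'M[R]_m; _ : symmx_val \in symmetric_pred }.
HB.instance Definition _ := [isSub for symmx_val].
HB.instance Definition _ := [Choice of symmx by <:].
HB.instance Definition _ := [SubChoice_isSubLmodule of symmx by <:].

Let symnorm (K : symmx) : R := `|symmx_val K|.

Let symnormD (K L : symmx) : symnorm (K + L) <= symnorm K + symnorm L.
Proof. exact: ler_normD. Qed.

Let symnormZ (a : R) (K : symmx) : symnorm (a *: K) = `|a| * symnorm K.
Proof. exact: normrZ. Qed.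

Let symnorm0_eq0 (K : symmx) : symnorm K = 0 -> K = 0.
Proof. by move=> /normr0_eq0 K0; apply: val_inj. Qed.

HB.instance Definition _ :=
  Lmodule_isNormed.Build R symmx symnormD symnormZ symnorm0_eq0.

End SymmetricMatrices.

Section ComplexFunctions.
Variable R : realType.

Definition cexp (z : R[i]) : R[i] :=
  (expR (complex.Re z) * cos (complex.Im z)) +i*
  (expR (complex.Re z) * sin (complex.Im z)).

Definition cexp_pii (z : R[i]) : R[i] := cexp ((0 +i* pi) * z).

Definition cderive1 (u : R -> R[i]) (t : R) : R[i] :=
  derive1 (@complex.Re R \o u) t +i* derive1 (@complex.Im R \o u) t.

(* Frechet differentiability over the complex field at every point *)
Definition holomorphic m n (f : 'M[R[i]]_(m, n) -> R[i]^o) : Prop :=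
  forall W, differentiable f W.

(* On a finite-dimensional V, which is the only case used, f is C^(k+1) iff it
   is differentiable and all its directional derivatives are C^k. *)
Fixpoint Ck (V : normedModType R) (k : nat) (f : V -> R) : Prop :=
  if k is k'.+1 then
    (forall x, differentiable f x) /\ (forall v, Ck k' ('D_v f))
  else continuous f.

Definition csmooth (V : normedModType R) (phi : V -> R[i]^o) : Prop :=
  forall k, Ck k (@complex.Re R \o phi) /\ Ck k (@complex.Im R \o phi).

Definition posdefmx m (A : 'M[R]_m) : Prop :=
  forall v : 'cV[R]_m, v != 0 -> 0 < (v^T *m A *m v) 0 0.

Definition siegel n (Omega : 'M[R[i]]_n) : Prop :=
  Omega^T = Omega /\ posdefmx (map_mx (@complex.Im R) Omega).

Definition cmx m n (A : 'M[R]_(m, n)) : 'M[R[i]]_(m, n) :=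
  map_mx (real_complex R) A.

End ComplexFunctions.

(* Elements [lambda, mu, kappa] *)
Notation heis R m n := ('M[R]_(m, n) * 'M[R]_(m, n) * symmx R m)%type.

Section Heisenberg.
Variables (R : realType) (m n : nat).

Fact heis_kappa_sym (l m0 : 'M[R]_(m, n)) (k k0 : symmx R m) :
  (k : 'M[R]_m) + k0 + l *m m0^T + m0 *m l^T \in @symmetric_pred R m.
Proof.
case: k k0 => [k /eqP sk] [k0 /eqP sk0] /=; apply/eqP.
by rewrite !linearD /= sk sk0 !trmx_mul !trmxK addrAC.
Qed.

Definition heis_mul (g g0 : heis R m n) : heis R m n :=
  (g.1.1 + g0.1.1, g.1.2 + g0.1.2,
   SymMx (heis_kappa_sym g.1.1 g0.1.2 g.2 g0.2)).

(* X is represented by its one-parameter subgroup t |-> exp(tX). *)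
Definition lieD (expX : R -> heis R m n) (phi : heis R m n -> R[i]^o)
    (g0 : heis R m n) : R[i] :=
  cderive1 (fun t => phi (heis_mul g0 (expX t))) 0.

Definition exp_X (k : 'I_m) (a : 'I_n) (t : R) : heis R m n :=
  (t *: delta_mx k a, 0, 0).

Definition exp_Xhat (k : 'I_m) (a : 'I_n) (t : R) : heis R m n :=
  (0, t *: delta_mx k a, 0).

Variables (S : 'M[int]_m) (Omega : 'M[R[i]]_n).

Definition theta_space : set ('M[R[i]]_(m, n) -> R[i]^o) :=
  [set f | holomorphic f /\
    forall (W : 'M[R[i]]_(m, n)) (xi eta : 'M[int]_(m, n)),
      let xiC : 'M[R[i]]_(m, n) := map_mx intr xi in
      let etaC : 'M[R[i]]_(m, n) := map_mx intr eta in
      f (W + xiC *m Omega + etaC) =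
      cexp_pii (- \tr (map_mx intr S *m
                  (xiC *m Omega *m xiC^T + 2 *: (xiC *m W^T)))) * f W].

Definition aut_space : set (heis R m n -> R[i]^o) :=
  [set phi | csmooth phi /\
    [/\ forall (xi eta : 'M[int]_(m, n)) (g0 : heis R m n),
          phi (heis_mul (map_mx intr xi, map_mx intr eta, 0) g0) = phi g0,
        forall (kappa : symmx R m) (g0 : heis R m n),
          phi (heis_mul g0 (0, 0, kappa)) =
          cexp_pii (\tr (map_mx intr S *m cmx kappa)) * phi g0
      & forall (k : 'I_m) (a : 'I_n) (g0 : heis R m n),
          lieD (exp_X k a) phi g0
          - \sum_(b < n) Omega a b * lieD (exp_Xhat k b) phi g0 = 0]].

Definition Jtilde0 (g0 : heis R m n) : R[i] :=
  cexp_pii (\tr (map_mx intr S *m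
    (cmx g0.1.1 *m Omega *m (cmx g0.1.1)^T + cmx g0.2))).

Definition act0 (g0 : heis R m n) : 'M[R[i]]_(m, n) :=
  cmx g0.1.1 *m Omega + cmx g0.1.2.

Definition phi_of (f : 'M[R[i]]_(m, n) -> R[i]^o) (g0 : heis R m n) : R[i]^o :=
  Jtilde0 g0 * f (act0 g0).

Definition f_of (phi : heis R m n -> R[i]^o)
    (W : 'M[R[i]]_(m, n)) : R[i]^o :=
  let g0 : heis R m n := get [set g | act0 g = W] in (Jtilde0 g0)^-1 * phi g0.

End Heisenberg.

(* Main.v *)
(* Since [Omega] has an invertible imaginary part, [lambda Omega + mu] determines
   [lambda] and [mu], and (b) prescribes the dependence of [phi] on [kappa]; hence
   [phi = J~ . (f o act0)] for a unique [f].  Expanding [sigma(S .)] with [S] and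
   [Omega] symmetric matches (a) with the quasi-periodicity of [f].

   The function [F(L, M, K) = e^{pi i sigma(S(L Omega tL + K))} f(L Omega + M)]
   extends [phi_f] holomorphically to complex matrices, and the operator in (c) is
   the derivative of [F] along [(E, - E Omega, - L Omega tE - E Omega tL)]; along
   this direction the argument of [f] is constant and the exponent is an even
   function of the parameter, so (c) holds.  Conversely [psi = phi / J~] satisfies
   (c) and does not depend on [kappa], so its real derivative along the section
   [W |-> (lambda, mu, 0)] is [h |-> sum h_kb d psi(0, E_kb, 0)], which is complex
   linear.

   Smoothness of [phi_f] reduces to: if [F] is complex differentiable then so is
   each directional derivative.  This follows from
   [2 pi D_v F(W) = int_0^{2 pi} (F(W + e^{ix} v) - F(W)) e^{-ix} dx], proved by
   shifting the line of integration of a periodic entire function; the shift is a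
   Goursat argument which needs antiderivatives in each real variable only. *)
Require Import Defs.
From HB Require Import structures.
From mathcomp Require Import all_boot all_order all_algebra.
From mathcomp Require Import complex ring lra.
From mathcomp Require Import all_classical all_reals all_analysis.

Set Implicit Arguments.
Unset Strict Implicit.
Unset Printing Implicit Defensive.
Import Order.TTheory GRing.Theory Num.Theory.
Import numFieldNormedType.Exports.

Local Open Scope classical_set_scope.
Local Open Scope ring_scope.
Local Open Scope complex_scope.

(** * Closed forms with pointwise differentiable coefficients *)

Section Goursat.
Variable R : realType.
Implicit Types (F A B P Q : R -> R -> R) (a b c d e : R).

Lemma mvt_bound (f df : R -> R) a b K : a <= b ->
  (forall x, a <= x <= b -> is_derive x 1 f (df x)) ->
  (forall x, a <= x <= b -> `|df x| <= K) ->
  `|f b - f a| <= K * (b - a).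
Proof.
move=> ab fdf dfK.
have [| |x] := @MVT_segment R f df a b ab.
- move=> x; rewrite in_itv /= => /andP[ax xb]; apply: fdf.
  by rewrite !ltW.
- apply: derivable_within_continuous => x; rewrite in_itv /= => xab.
  by have := fdf x xab; case.
rewrite in_itv /= => xab ->; rewrite normrM (ger0_norm (_ : 0 <= b - a)) ?subr_ge0//.
by rewrite ler_wpM2r ?subr_ge0 ?dfK.
Qed.

(** If [P] is the derivative of [F] in the first variable, this is the integral of [P dx] over the
    top edge minus that over the bottom edge; if [Q] is the derivative in the second variable, it is
    the integral of [Q dy] over the right edge minus that over the left edge. Equality of the two
    for a closed form [P dx + Q dy] is Cauchy's theorem on a rectangle. *)
Definition mixed_diff F a b c d := F b d - F a d - F b c + F a c.

(** The mixed difference is additive under cutting the rectangle into four, so one of the quarters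
    carries at least a quarter of its absolute value. *)
Lemma mixed_diff_quarter F a c w l : exists p : R * R,
  [/\ p.1 = a \/ p.1 = a + w / 2, p.2 = c \/ p.2 = c + l / 2 &
      `|mixed_diff F a (a + w) c (c + l)| <=
      4 * `|mixed_diff F p.1 (p.1 + w / 2) p.2 (p.2 + l / 2)|].
Proof.
set a' := a + w / 2; set c' := c + l / 2.
have Ea : a' + w / 2 = a + w by rewrite /a'; field.
have Ec : c' + l / 2 = c + l by rewrite /c'; field.
set D := mixed_diff F.
have DE : D a (a + w) c (c + l) =
    D a a' c c' + D a' (a + w) c c' + D a a' c' (c + l) + D a' (a + w) c' (c + l).
  by rewrite /D /mixed_diff; ring.
have DEle : `|D a (a + w) c (c + l)| <= `|D a a' c c'| + `|D a' (a + w) c c'| +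
    `|D a a' c' (c + l)| + `|D a' (a + w) c' (c + l)|.
  by rewrite DE; do 3!(apply: (le_trans (ler_normD _ _)); apply: lerD => //).
set N := `|D a (a + w) c (c + l)| in DEle *.
have [n1|n1] := leP N (4 * `|D a a' c c'|).
  by exists (a, c); split => /=; [left|left|exact: n1].
have [n2|n2] := leP N (4 * `|D a' (a + w) c c'|).
  by exists (a', c); split => /=; [right|left|rewrite Ea; exact: n2].
have [n3|n3] := leP N (4 * `|D a a' c' (c + l)|).
  by exists (a, c'); split => /=; [left|right|rewrite Ec; exact: n3].
by exists (a', c'); split => /=; [right|right|rewrite Ea Ec -/D; lra].
Qed.

(** The left ends increase and the right ends decrease, so the supremum of the left ends lies in
    every interval. *)
Lemma nested_halving (a : nat -> R) w : 0 <= w ->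
  (forall k, a k.+1 = a k \/ a k.+1 = a k + w / 2 ^+ k / 2) ->
  exists x, forall k, a k <= x <= a k + w / 2 ^+ k.
Proof.
move=> w0 aS.
have wk0 k : 0 <= w / 2 ^+ k by rewrite divr_ge0 ?exprn_ge0.
have wS k : w / 2 ^+ k.+1 = w / 2 ^+ k / 2.
  by rewrite exprS invfM; ring.
have up : {homo a : i j / (i <= j)%N >-> i <= j}.
  apply: homo_leq => //; first exact: le_trans.
  by move=> k; have := wk0 k; case: (aS k) => ->; lra.
have dn : {homo (fun k => a k + w / 2 ^+ k) : i j / (i <= j)%N >-> i >= j}.
  apply: (@homo_leq _ _ (fun x y => y <= x)) => //.
    by move=> y x z xy yz; exact: le_trans yz xy.
  by move=> k; rewrite wS; have := wk0 k; case: (aS k) => ->; lra.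
have ub k : ubound (range a) (a k + w / 2 ^+ k).
  move=> _ [j _ <-].
  have [jk|/ltnW kj] := leqP j k.
    by have := up _ _ jk; have := wk0 k; lra.
  by have := dn _ _ kj; have := wk0 j; rewrite /=; lra.
exists (sup (range a)) => k; apply/andP; split.
  apply: ub_le_sup; last by exists k.
  by exists (a 0 + w / 2 ^+ 0); exact: ub.
by apply: ge_sup => //; exists (a 0); exists 0.
Qed.

(** Goursat's bisection: repeated quartering loses at most a factor [4] per level, while the local
    bound at the limit point decays like the squared side lengths, hence also by [4] per level. An
    arbitrarily small [e] then excludes a nonzero value. *)
Lemma mixed_diff_eq0 F a b c d : a < b -> c < d ->
  (forall x y, a <= x <= b -> c <= y <= d -> forall e, 0 < e -> exists2 r, 0 < r &
     forall a' b' c' d', a <= a' <= x -> x <= b' <= b -> c <= c' <= y ->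
       y <= d' <= d -> b' - a' < r -> d' - c' < r ->
       `|mixed_diff F a' b' c' d'| <= e * (b' - a' + (d' - c')) ^+ 2) ->
  mixed_diff F a b c d = 0.
Proof.
move=> ab cd loc; apply: contrapT => /eqP; rewrite -normr_gt0 => D0.
set w := b - a; set l := d - c.
have w0 : 0 < w by rewrite subr_gt0.
have l0 : 0 < l by rewrite subr_gt0.
(* The state is the level together with the lower left corner; the side lengths are determined by
   the level. *)
have [g gP] := choice (fun q : nat * (R * R) => mixed_diff_quarter F
  q.2.1 q.2.2 (w / 2 ^+ q.1) (l / 2 ^+ q.1)).
pose s := fix s k := if k is j.+1 then g (j, s j) else (a, c).
have aS k : (s k.+1).1 = (s k).1 \/ (s k.+1).1 = (s k).1 + w / 2 ^+ k / 2.
  by have [] := gP (k, s k).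
have cS k : (s k.+1).2 = (s k).2 \/ (s k.+1).2 = (s k).2 + l / 2 ^+ k / 2.
  by have [] := gP (k, s k).
have half (u : R) k : u / 2 ^+ k.+1 = u / 2 ^+ k / 2.
  by rewrite exprS invfM; ring.
pose D k := `|mixed_diff F (s k).1 ((s k).1 + w / 2 ^+ k)
                          (s k).2 ((s k).2 + l / 2 ^+ k)|.
have DS k : D k <= 4 * D k.+1.
  by rewrite /D !half; have [] := gP (k, s k).
have D0k k : D 0%N <= 4 ^+ k * D k.
  elim: k => [|k IH]; first by rewrite expr0 mul1r.
  apply: (le_trans IH); rewrite exprSr -mulrA ler_wpM2l ?exprn_ge0//.
have [x xP] := nested_halving (ltW w0) aS.
have [y yP] := nested_halving (ltW l0) cS.
have sa k : a <= (s k).1 /\ (s k).1 + w / 2 ^+ k <= b.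
  elim: k => [|k [IH1 IH2]].
    by rewrite /= expr0 divr1 /w; split; lra.
  rewrite half; have : 0 <= w / 2 ^+ k by rewrite divr_ge0 ?exprn_ge0 ?ltW.
  by case: (aS k) => ->; lra.
have sc k : c <= (s k).2 /\ (s k).2 + l / 2 ^+ k <= d.
  elim: k => [|k [IH1 IH2]].
    by rewrite /= expr0 divr1 /l; split; lra.
  rewrite half; have : 0 <= l / 2 ^+ k by rewrite divr_ge0 ?exprn_ge0 ?ltW.
  by case: (cS k) => ->; lra.
have DE : D 0%N = `|mixed_diff F a b c d|.
  rewrite /D /= !expr0 !divr1 /w /l.
  by rewrite !addrA ![_ + b]addrC ![_ + d]addrC !addrK.
(* With this [e] the powers of [4] cancel and the bound on [D 0] becomes [D 0 / 2]. *)
pose e := D 0%N / (2 * (w + l) ^+ 2).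
have wl2 : 0 < (w + l) ^+ 2 by apply: exprn_gt0; exact: addr_gt0.
have e0 : 0 < e by rewrite divr_gt0 ?DE// mulr_gt0.
have xab : a <= x <= b.
  have [h1 h2] := sa 0%N; have /andP[h3 h4] := xP 0%N.
  by apply/andP; split; lra.
have ycd : c <= y <= d.
  have [h1 h2] := sc 0%N; have /andP[h3 h4] := yP 0%N.
  by apply/andP; split; lra.
have [r r0 rP] := loc x y xab ycd e e0.
have [k] : exists k, (w + l) / 2 ^+ k < r.
  have /cvgrPdist_lt/(_ _ r0)[k _ /(_ k (leqnn k))] :
      (fun k => (w + l) * (2^-1) ^+ k) @ \oo --> 0.
    rewrite -[X in _ --> X](mulr0 (w + l)); apply: cvgMl_tmp.
    by apply: cvg_expr; rewrite ger0_norm//; lra.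
  rewrite /= sub0r normrN exprVn => kr; exists k.
  by apply: le_lt_trans kr; exact: ler_norm.
rewrite mulrDl => kr.
have w2k : 0 < w / 2 ^+ k by rewrite divr_gt0 ?exprn_gt0.
have l2k : 0 < l / 2 ^+ k by rewrite divr_gt0 ?exprn_gt0.
have : D k <= e * ((w + l) / 2 ^+ k) ^+ 2.
  have [h1 h2] := sa k; have /andP[h3 h4] := xP k.
  have [h5 h6] := sc k; have /andP[h7 h8] := yP k.
  have -> : (w + l) / 2 ^+ k = (s k).1 + w / 2 ^+ k - (s k).1 +
     ((s k).2 + l / 2 ^+ k - (s k).2) by ring.
  by apply: rP; rewrite ?h1 ?h2 ?h3 ?h4 ?h5 ?h6 ?h7 ?h8//; lra.
move=> Dk.
have : D 0%N <= 4 ^+ k * (e * ((w + l) / 2 ^+ k) ^+ 2).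
  by apply: le_trans (D0k k) _; rewrite ler_wpM2l ?exprn_ge0.
have -> : 4 ^+ k * (e * ((w + l) / 2 ^+ k) ^+ 2) = D 0%N / 2.
  have -> : (4 : R) ^+ k = (2 ^+ k) ^+ 2.
    by rewrite -exprM mulnC exprM; congr (_ ^+ _); ring.
  rewrite /e; field; apply/andP; split; last exact/lt0r_neq0/addr_gt0.
  by rewrite expf_neq0.
by rewrite DE; lra.
Qed.

Lemma mvt_affine (f df : R -> R) a b D K : a <= b ->
  (forall x, a <= x <= b -> is_derive x 1 f (df x)) ->
  (forall x, a <= x <= b -> `|df x - D| <= K) ->
  `|f b - f a - D * (b - a)| <= K * (b - a).
Proof.
move=> ab fdf dfK; pose g x := f x - D * x.
have -> : f b - f a - D * (b - a) = g b - g a by rewrite /g; ring.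
apply: (@mvt_bound g (fun x => df x - D)) => // x xab.
have ? := fdf x xab; apply: is_derive_eq.
by rewrite /GRing.scale /= mulr1.
Qed.

Lemma in_segment_dist a b x y : a <= x <= b -> a <= y <= b -> `|x - y| <= b - a.
Proof. by move=> /andP[? ?] /andP[? ?]; rewrite ler_norml; lra. Qed.

Lemma affine_increment (u u' z p q s t t' k : R) :
  `|u - z - p * s - q * t| <= k -> `|u' - z - p * s - q * t'| <= k ->
  `|u - u' - q * (t - t')| <= k + k.
Proof.
have -> : u - u' - q * (t - t') = (u - z - p * s - q * t) - (u' - z - p * s - q * t').
  by ring.
by move=> h h'; apply: le_trans (ler_normB _ _) _; exact: lerD.
Qed.

(** The common coefficient [p2] says that the form is closed at each point; no continuity of the
    partial derivatives enters. Near a point both mixed differences equal [p2] times the area, up to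
    an error quadratic in the side lengths, so their difference satisfies the bisection
    criterion. *)
Lemma closed_form_mixed_diff A B P Q a b c d : a < b -> c < d ->
  (forall x y, a <= x <= b -> c <= y <= d -> is_derive x 1 (A^~ y) (P x y)) ->
  (forall x y, a <= x <= b -> c <= y <= d -> is_derive y 1 (B x) (Q x y)) ->
  (forall x0 y0, exists p1 p2 q2 : R, forall e, 0 < e -> exists2 r, 0 < r &
     forall x y, `|x - x0| < r -> `|y - y0| < r ->
     `|P x y - P x0 y0 - p1 * (x - x0) - p2 * (y - y0)| <=
        e * (`|x - x0| + `|y - y0|) /\
     `|Q x y - Q x0 y0 - p2 * (x - x0) - q2 * (y - y0)| <=
        e * (`|x - x0| + `|y - y0|)) ->
  mixed_diff A a b c d = mixed_diff B a b c d.
Proof.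
move=> ab cd dA dB dPQ; apply/eqP; rewrite -subr_eq0; apply/eqP.
have := @mixed_diff_eq0 (fun x y => A x y - B x y) a b c d ab cd.
have DE a' b' c' d' : mixed_diff (fun x y => A x y - B x y) a' b' c' d' =
    mixed_diff A a' b' c' d' - mixed_diff B a' b' c' d'.
  by rewrite /mixed_diff; ring.
rewrite DE; apply=> x0 y0 x0ab y0cd e e0.
(* With [s] the sum of the two side lengths and [K = (e / 2) * s], the errors of the two mixed
   differences add up to [2 * K * s = e * s ^+ 2]. *)
have e20 : 0 < e / 2 by rewrite divr_gt0.
have [p1 [p2 [q2 /(_ _ e20)[r r0 rP]]]] := dPQ x0 y0.
exists r => // a' b' c' d' /andP[aa' a'x] /andP[xb' b'b] /andP[cc' c'y] /andP[yd' d'd].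
move=> wr lr; rewrite DE.
have ab' : a' <= b' := le_trans a'x xb'.
have cd' : c' <= d' := le_trans c'y yd'.
have x0ab' : a' <= x0 <= b' by rewrite a'x.
have y0cd' : c' <= y0 <= d' by rewrite c'y.
have sub_x x : a' <= x <= b' -> a <= x <= b.
  by move=> /andP[h1 h2]; rewrite (le_trans aa' h1) (le_trans h2 b'b).
have sub_y y : c' <= y <= d' -> c <= y <= d.
  by move=> /andP[h1 h2]; rewrite (le_trans cc' h1) (le_trans h2 d'd).
have ca : c' <= c' <= d' by rewrite lexx.
have da : c' <= d' <= d' by rewrite cd' lexx.
have aa : a' <= a' <= b' by rewrite lexx.
have ba : a' <= b' <= b' by rewrite ab' lexx.
clear dPQ aa' a'x xb' b'b cc' c'y yd' d'd x0ab y0cd ab cd.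
set K := e / 2 * (b' - a' + (d' - c')).
have near x y : a' <= x <= b' -> c' <= y <= d' ->
    `|P x y - P x0 y0 - p1 * (x - x0) - p2 * (y - y0)| <= K /\
    `|Q x y - Q x0 y0 - q2 * (y - y0) - p2 * (x - x0)| <= K.
  move=> xab ycd.
  have h1 := in_segment_dist xab x0ab'; have h2 := in_segment_dist ycd y0cd'.
  have [hP hQ] := rP _ _ (le_lt_trans h1 wr) (le_lt_trans h2 lr).
  have hK : e / 2 * (`|x - x0| + `|y - y0|) <= K by rewrite ler_pM2l// lerD.
  by split; [apply: le_trans hP hK|rewrite addrAC; apply: le_trans hQ hK].
(* The mean value theorem is applied to the difference of [A] along the top and bottom edges; its
   derivative is [p2 * (d' - c')] up to [K + K], the terms in [p1] having cancelled. *)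
have hA : `|mixed_diff A a' b' c' d' - p2 * (d' - c') * (b' - a')| <=
          (K + K) * (b' - a').
  have -> : mixed_diff A a' b' c' d' = A b' d' - A b' c' - (A a' d' - A a' c').
    by rewrite /mixed_diff; ring.
  apply: (@mvt_affine (fun x => A x d' - A x c') (fun x => P x d' - P x c')) => // x xab.
    have ? := dA x d' (sub_x _ xab) (sub_y _ da).
    have ? := dA x c' (sub_x _ xab) (sub_y _ ca).
    exact: is_derive_eq.
  rewrite (_ : d' - c' = d' - y0 - (c' - y0)); last by ring.
  exact: affine_increment (near x d' xab da).1 (near x c' xab ca).1.
have hB : `|mixed_diff B a' b' c' d' - p2 * (b' - a') * (d' - c')| <=
          (K + K) * (d' - c').
  have -> : mixed_diff B a' b' c' d' = B b' d' - B a' d' - (B b' c' - B a' c').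
    by rewrite /mixed_diff; ring.
  apply: (@mvt_affine (fun y => B b' y - B a' y) (fun y => Q b' y - Q a' y)) => // y ycd.
    have ? := dB b' y (sub_x _ ba) (sub_y _ ycd).
    have ? := dB a' y (sub_x _ aa) (sub_y _ ycd).
    exact: is_derive_eq.
  rewrite (_ : b' - a' = b' - x0 - (a' - x0)); last by ring.
  exact: affine_increment (near b' y ba ycd).2 (near a' y aa ycd).2.
have -> : mixed_diff A a' b' c' d' - mixed_diff B a' b' c' d' =
  mixed_diff A a' b' c' d' - p2 * (d' - c') * (b' - a') -
  (mixed_diff B a' b' c' d' - p2 * (b' - a') * (d' - c')) by ring.
apply: le_trans (ler_normB _ _) _; apply: le_trans (lerD hA hB) _.
by rewrite le_eqVlt; apply/orP; left; apply/eqP; rewrite /K; field.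
Qed.

End Goursat.

(** * Integrals over a period and real-valued norms *)

Section PeriodIntegral.
Variable R : realType.
Implicit Types (f g h : R -> R) (x : R).
Notation mu := (@lebesgue_measure R).

(* The base point [-1] makes this an antiderivative around every point of
   [[0, +oo[], end point [0] included. *)
Definition primitive h (x : R) : R := (\int[mu]_(t in `[(-1)%R, x]) h t)%R.

Lemma is_derive_primitive h x : continuous h -> -1 < x ->
  is_derive x 1 (primitive h) (h x).
Proof.
move=> ch x1; have xx : x < x + 1 by rewrite ltrDl.
have ih : mu.-integrable `[-1, x + 1] (EFin \o h).
  apply: continuous_compact_integrable; first exact: segment_compact.
  exact: continuous_subspaceT.
have [dP PE] := @continuous_FTC1_closed R h (-1) x (x + 1) xx ih x1 (ch x).
by split; [exact: dP|rewrite -derive1E; exact: PE].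
Qed.

(** The integral over [[0, 2 pi]], written as an increment of [primitive] because mixed differences
    of primitives yield it in exactly this shape. *)
Definition rint h : R := primitive h (pi *+ 2) - primitive h 0.

Let tau0 : 0 <= pi *+ 2 :> R. Proof. by rewrite mulrn_wge0 ?pi_ge0. Qed.

(** Two antiderivatives differ by a constant, by [mvt_bound] with [K = 0]. Linearity of the integral
    then reduces to linearity of derivatives. *)
Lemma rint_unique h f : continuous h ->
  (forall x, 0 <= x <= pi *+ 2 -> is_derive x 1 f (h x)) ->
  rint h = f (pi *+ 2) - f 0.
Proof.
move=> ch df; apply/eqP; rewrite -subr_eq0 -normr_le0.
have := @mvt_bound R (fun x => primitive h x - f x) (fun=> 0) _ _ 0 tau0.
rewrite mul0r => H; suff -> : rint h - (f (pi *+ 2) - f 0) =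
   primitive h (pi *+ 2) - f (pi *+ 2) - (primitive h 0 - f 0).
  apply: H => x x0; last by rewrite normr0.
  have ? : is_derive x 1 f (h x) by exact: df.
  have ? : is_derive x 1 (primitive h) (h x).
    by apply: is_derive_primitive => //; case/andP: x0 => x0 _; lra.
  by apply: is_derive_eq; rewrite subrr.
by rewrite /rint; ring.
Qed.

Lemma rintD f g : continuous f -> continuous g ->
  rint (fun x => f x + g x) = rint f + rint g.
Proof.
move=> cf cg; pose F x := primitive f x + primitive g x.
have -> : rint f + rint g = F (pi *+ 2) - F 0 by rewrite /rint /F; ring.
apply: rint_unique => [x|x /andP[x0 _]]; first by apply: cvgD; [exact: cf|exact: cg].
have x1 : -1 < x by lra.
have ? := is_derive_primitive cf x1; have ? := is_derive_primitive cg x1.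
exact: is_derive_eq.
Qed.

Lemma rintZ (c : R) f : continuous f -> rint (fun x => c * f x) = c * rint f.
Proof.
move=> cf; pose F x := c * primitive f x.
have -> : c * rint f = F (pi *+ 2) - F 0 by rewrite /rint /F; ring.
apply: rint_unique => [x|x /andP[x0 _]]; first by apply: cvgMl_tmp; exact: cf.
have x1 : -1 < x by lra.
have ? := is_derive_primitive cf x1.
by apply: is_derive_eq.
Qed.

Lemma rint_le f K : continuous f -> (forall x, `|f x| <= K) ->
  `|rint f| <= K * (pi *+ 2).
Proof.
move=> cf fK; rewrite -[pi *+ 2]subr0.
apply: (@mvt_bound R (primitive f) f _ _ K tau0) => x // /andP[x0 _].
by apply: is_derive_primitive => //; lra.
Qed.

End PeriodIntegral.

Section RealNorm.
Variable R : realType.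

(* Norms over [R[i]] take values in [R[i]], which is only partially ordered. *)
Definition nr (V : normedModType R[i]) (v : V) : R := complex.Re `|v|.

Section Generic.
Variable V : normedModType R[i].
Implicit Types u v : V.

Lemma nrE v : `|v| = (nr v)%:C.
Proof. by rewrite /nr RRe_real// normr_real. Qed.

Lemma nr_ge0 v : 0 <= nr v.
Proof. by rewrite -ler0c -nrE. Qed.

Lemma nrD u v : nr (u + v) <= nr u + nr v.
Proof. by rewrite -lecR rmorphD /= -!nrE ler_normD. Qed.

Lemma nrN v : nr (- v) = nr v.
Proof. by rewrite /nr normrN. Qed.

Lemma nr0 : nr (0 : V) = 0.
Proof. by rewrite /nr normr0. Qed.

Lemma nrB u v : nr (u - v) <= nr u + nr v.
Proof. by rewrite -(nrN v) nrD. Qed.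

Lemma nrZ (c : R[i]) v : nr (c *: v) = nr (c : R[i]^o) * nr v.
Proof. by apply: complexI; rewrite rmorphM /= -!nrE normrZ. Qed.

Lemma nr_eq0 v : nr v = 0 -> v = 0.
Proof. by move=> v0; apply/normr0_eq0; rewrite nrE v0. Qed.

Lemma nbhs_nr v (P : set V) :
  nbhs v P <-> exists2 r : R, 0 < r & forall u, nr u < r -> P (v + u).
Proof.
split.
  move=> /nbhs_normP[/= e e0 eP].
  have eE : e = (complex.Re e)%:C by rewrite RRe_real// realE ltW.
  exists (complex.Re e); first by rewrite -ltcR -eE.
  move=> u ur; apply: eP; rewrite /= opprD addNKr normrN.
  by rewrite nrE eE ltcR.
move=> [r r0 rP]; apply/nbhs_normP; exists r%:C; first by rewrite /= ltcR.
move=> u /=; rewrite distrC nrE ltcR => /rP.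
by rewrite addrC subrK.
Qed.

End Generic.

Implicit Types z w : R[i]^o.

Lemma nrM z w : nr (z * w : R[i]^o) = nr z * nr w.
Proof. exact: nrZ. Qed.

Lemma nrV z : nr (z^-1 : R[i]^o) = (nr z)^-1.
Proof. by apply: complexI; rewrite fmorphV /= -!nrE normfV. Qed.

Lemma nr_real (r : R) : nr (r%:C : R[i]^o) = `|r|.
Proof.
have E x : 0 <= x -> nr (x%:C : R[i]^o) = x.
  move=> x0; apply: complexI; rewrite -nrE.
  have x0' : 0 <= x%:C by rewrite ler0c.
  exact: (ger0_norm x0').
have [r0|r0] := leP 0 r; first by rewrite E// ger0_norm.
rewrite ltr0_norm// -[RHS]E ?oppr_ge0 ?ltW// -[LHS]nrN.
by congr (complex.Re `|_|); rewrite rmorphN.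
Qed.

Lemma nr_sqr z : nr z ^+ 2 = complex.Re z ^+ 2 + complex.Im z ^+ 2.
Proof. by apply: complexI; rewrite rmorphXn /= -nrE -add_Re2_Im2. Qed.

Lemma Re_le_nr z : `|complex.Re z| <= nr z.
Proof.
rewrite -ler_sqr ?nnegrE ?nr_ge0// real_normK ?num_real// nr_sqr.
by rewrite lerDl sqr_ge0.
Qed.

Lemma Im_le_nr z : `|complex.Im z| <= nr z.
Proof.
rewrite -ler_sqr ?nnegrE ?nr_ge0// real_normK ?num_real// nr_sqr.
by rewrite lerDr sqr_ge0.
Qed.

Lemma nr_le z : nr z <= `|complex.Re z| + `|complex.Im z|.
Proof.
rewrite -ler_sqr ?nnegrE ?nr_ge0 ?addr_ge0// nr_sqr sqrrD !real_normK ?num_real//.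
by rewrite -addrA lerD2l lerDr mulrn_wge0 ?mulr_ge0.
Qed.

End RealNorm.

(** * Differentiability as a first-order expansion with explicit radii *)

Section DiffExpansion.
Variables (K : numFieldType) (V W : normedModType K).

Lemma diff_expand (f : V -> W) x : differentiable f x ->
  forall e, 0 < e -> exists2 r, 0 < r &
    forall h, `|h| < r -> `|f (x + h) - f x - 'd f x h| <= e * `|h|.
Proof.
move=> /diff_locallyP[_ dfx] e e0.
move/eqaddoP : dfx => /(_ e e0)/nbhs_norm0P[/= r r0 rP].
exists r => // h hr.
have -> : f (x + h) - f x - 'd f x h = (f \o shift x - (cst (f x) + 'd f x)) h.
  by rewrite [x + h]addrC -addrA -opprD.
exact: rP.
Qed.

(** The bound by [k] makes [df] continuous, which is not automatic for a linear map on an arbitrary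
    normed space and is required of a differential. *)
Lemma expand_diff (f : V -> W) x (df : {linear V -> W}) k : 0 < k ->
  (forall h, `|df h| <= k * `|h|) ->
  (forall e, 0 < e -> exists2 r, 0 < r &
    forall h, `|h| < r -> `|f (x + h) - f x - df h| <= e * `|h|) ->
  differentiable f x /\ 'd f x = df :> (V -> W).
Proof.
move=> k0 dfk fx.
have cdf : continuous df.
  apply: bounded_linear_continuous; apply/ex_bound; exists k.
  apply/nbhs_norm0P; exists 1 => //= h /ltW h1.
  by apply: le_trans (dfk h) _; rewrite ger_pMr.
have E : f \o shift x = cst (f x) + df +o_ 0 id.
  apply/eqaddoP => e e0; have [r r0 rP] := fx e e0.
  apply/nbhs_norm0P; exists r => //= h hr.
  have -> : (f \o shift x - (cst (f x) + (df : V -> W))) h = f (x + h) - f x - df h.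
    by rewrite [x + h]addrC -addrA -opprD.
  exact: rP.
have dE := diff_unique cdf E.
split => //; apply/diff_locallyP; split; first by rewrite dE.
by rewrite dE.
Qed.

End DiffExpansion.

(** * The complex exponential *)

Section ComplexDiff.
Variable R : realType.

Section Generic.
Variables (V W : normedModType R[i]).
Implicit Types (F : V -> W) (x : V).

Lemma diff_nr F x : differentiable F x ->
  forall e, 0 < e -> exists2 r : R, 0 < r &
    forall h, nr h < r -> nr (F (x + h) - F x - 'd F x h) <= e * nr h.
Proof.
move=> dF e e0; have e0' : 0 < e%:C by rewrite ltcR.
have [r r0 rP] := diff_expand dF e0'.
have rE : r = (complex.Re r)%:C by rewrite RRe_real// realE ltW.
exists (complex.Re r); first by rewrite -ltcR -rE.
move=> h; rewrite -ltcR -rE -nrE => /rP.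
by rewrite !nrE -rmorphM lecR.
Qed.

Lemma nr_diff F x (df : {linear V -> W}) k : 0 < k ->
  (forall h, nr (df h) <= k * nr h) ->
  (forall e, 0 < e -> exists2 r : R, 0 < r &
    forall h, nr h < r -> nr (F (x + h) - F x - df h) <= e * nr h) ->
  differentiable F x /\ 'd F x = df :> (V -> W).
Proof.
move=> k0 dfk Fx; apply: (@expand_diff _ _ _ F x df k%:C).
- by rewrite ltcR.
- by move=> h; rewrite !nrE -rmorphM lecR.
- move=> e e0; have eE : e = (complex.Re e)%:C by rewrite RRe_real// realE ltW.
  have [|r r0 rP] := Fx (complex.Re e); first by rewrite -ltcR -eE.
  exists r%:C; first by rewrite ltcR.
  by move=> h; rewrite !nrE ltcR eE -rmorphM lecR => /rP.
Qed.

Lemma diff_bounded F x : differentiable F x ->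
  exists2 k : R, 0 < k & forall h, nr ('d F x h) <= k * nr h.
Proof.
move=> dF; have [k k0 kP] := linear_lipschitz (diff_continuous dF).
have kE : k = (complex.Re k)%:C by rewrite RRe_real// realE ltW.
exists (complex.Re k); first by rewrite -ltcR -kE.
by move=> h; rewrite -lecR rmorphM /= -kE -!nrE.
Qed.

Lemma continuous_nr F x : {for x, continuous F} <->
  forall e, 0 < e -> exists2 r : R, 0 < r & forall h, nr h < r -> nr (F (x + h) - F x) < e.
Proof.
split=> [/cvgrPdist_lt Fx e e0|Fx].
  have /Fx/nbhs_nr[r r0 rP] : 0 < e%:C by rewrite ltcR.
  exists r => // h /rP; rewrite distrC nrE ltcR; exact.
apply/cvgrPdist_lt => e e0.
have eE : e = (complex.Re e)%:C by rewrite RRe_real// realE ltW.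
have [|r r0 rP] := Fx (complex.Re e); first by rewrite -ltcR -eE.
by apply/nbhs_nr; exists r => // h /rP; rewrite distrC nrE eE ltcR.
Qed.

End Generic.

Implicit Types (z w : R[i]).

Lemma real_expand (f : R -> R) (x c : R) : is_derive x 1 f c ->
  forall e, 0 < e -> exists2 r, 0 < r &
    forall h, `|h| < r -> `|f (x + h) - f x - h * c| <= e * `|h|.
Proof.
move=> [df fc] e e0; have /derivable1_diffP dfx := df.
have [r r0 rP] := diff_expand dfx e0; exists r => // h /rP.
by rewrite (deriv1E df) derive1E fc.
Qed.

Lemma cexpD z w : cexp (z + w) = cexp z * cexp w.
Proof.
case: z w => [a b] [c d]; rewrite /cexp /= expRD cosD sinD.
by apply/eqP; rewrite eq_complex /=; apply/andP; split; apply/eqP; ring.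
Qed.

Lemma cexp0 : cexp (0 : R[i]) = 1.
Proof.
by rewrite /cexp /= expR0 cos0 sin0 mul1r mulr0.
Qed.

Lemma nr_cexp z : nr (cexp z : R[i]^o) = expR (complex.Re z).
Proof.
apply/eqP; rewrite -(@eqrXn2 _ 2)// ?nr_ge0 ?expR_ge0//; apply/eqP.
by rewrite nr_sqr /= !exprMn -mulrDr cos2Dsin2 mulr1.
Qed.

Lemma cexp_neq0 z : cexp z != 0.
Proof.
apply/eqP => z0; have := nr_cexp z; rewrite z0 nr0 => /eqP.
by rewrite eq_sym gt_eqF ?expR_gt0.
Qed.

Lemma cexpN z : cexp (- z) = (cexp z)^-1.
Proof.
apply: (mulfI (cexp_neq0 z)).
by rewrite -cexpD subrr cexp0 mulfV ?cexp_neq0.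
Qed.

Lemma cexp_expand0 e : 0 < e -> exists2 r : R, 0 < r &
  forall h : R[i]^o, nr h < r -> nr (cexp h - 1 - h : R[i]^o) <= e * nr h.
Proof.
(* Each component of the error is at most [3 * (d * N)], so the total [6 * d * N] stays below
   [e * N]. The bound [d <= 1] gives [expR a <= 2], and the radius [d / 2] below gives
   [|expR a - 1| <= d]. *)
move=> e0; pose d := Num.min (e / 8) 1.
have d0 : 0 < d by rewrite lt_min divr_gt0/=.
have [de d1] : d <= e / 8 /\ d <= 1 by split; rewrite /d ge_min lexx ?orbT.
have [r1 r10 r1P] := real_expand (is_derive_expR 0) d0.
have [r2 r20 r2P] := real_expand (is_derive_cos 0) d0.
have [r3 r30 r3P] := real_expand (is_derive_sin 0) d0.
pose r := Num.min (Num.min r1 r2) (Num.min r3 (d / 2)).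
exists r; first by rewrite !lt_min r10 r20 r30 divr_gt0.
move=> [a b] hr.
have /= ha := Re_le_nr (a +i* b : R[i]^o); have /= hb := Im_le_nr (a +i* b : R[i]^o).
set N := nr _ in hr ha hb *; move: hr.
rewrite !lt_min => /andP[/andP[h1 h2] /andP[h3 h4]].
have := r1P a (le_lt_trans ha h1); rewrite add0r expR0 mulr1 => k1.
have := r2P b (le_lt_trans hb h2); rewrite add0r cos0 sin0 oppr0 mulr0 subr0 => k2.
have := r3P b (le_lt_trans hb h3); rewrite add0r sin0 cos0 mulr1 subr0 => k3.
have N0 : 0 <= N by exact: nr_ge0.
have dN : d * N <= N by rewrite ler_piMl.
have k1' : `|expR a - 1 - a| <= d * N.
  by apply: le_trans k1 _; rewrite ler_pM2l.
have k2' : `|cos b - 1| <= d * N.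
  by apply: le_trans k2 _; rewrite ler_pM2l.
have k3' : `|sin b - b| <= d * N.
  by apply: le_trans k3 _; rewrite ler_pM2l.
have ea1 : `|expR a - 1| <= d.
  have : `|expR a - 1| <= `|expR a - 1 - a| + `|a|.
    by apply: le_trans (ler_normD _ _); rewrite subrK.
  by move=> H; apply: le_trans H _; lra.
have ea : `|expR a| <= 2.
  have : `|expR a| <= `|expR a - 1| + `|1 : R|.
    by apply: le_trans (ler_normD _ _); rewrite subrK.
  by rewrite normr1; lra.
have two (u : R) : `|u| <= d * N -> `|expR a * u| <= 2 * (d * N).
  by move=> hu; rewrite normrM ler_pM.
have K1 : `|expR a * cos b - 1 - a| <= 3 * (d * N).
  have -> : expR a * cos b - 1 - a = expR a * (cos b - 1) + (expR a - 1 - a) by ring.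
  by apply: le_trans (ler_normD _ _) _; have := two _ k2'; lra.
have K2 : `|expR a * sin b - b| <= 3 * (d * N).
  have -> : expR a * sin b - b = expR a * (sin b - b) + (expR a - 1) * b by ring.
  apply: le_trans (ler_normD _ _) _; have := two _ k3'.
  have : `|(expR a - 1) * b| <= d * N by rewrite normrM ler_pM.
  by lra.
apply: le_trans (nr_le _) _; rewrite /= ?subr0.
have : d * N <= e / 8 * N by rewrite ler_wpM2r.
have := mulr_ge0 (ltW e0) N0.
by move: K1 K2; lra.
Qed.

(** The functional equation moves the expansion at [0] to [z]; the differential is multiplication by
    [cexp z]. *)
Lemma differentiable_cexp (z : R[i]^o) : differentiable (@cexp R : R[i]^o -> R[i]^o) z.
Proof.
have [||] := @nr_diff _ _ (@cexp R : R[i]^o -> R[i]^o) z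
  (cexp z \*o (@idfun R[i]^o)) (expR (complex.Re z)) (expR_gt0 _) _ _.
- by move=> h; rewrite /= nrM nr_cexp.
- move=> e e0; have [|r r0 rP] := @cexp_expand0 (e / expR (complex.Re z)).
    by rewrite divr_gt0 ?expR_gt0.
  exists r => // h hr; rewrite cexpD /=.
  have -> : cexp z * cexp h - cexp z - cexp z * h = cexp z * (cexp h - 1 - h) by ring.
  rewrite nrM nr_cexp.
  apply: le_trans (ler_wpM2l (expR_ge0 _) (rP h hr)) _.
  by rewrite mulrA mulrCA divff ?mulr1// gt_eqF ?expR_gt0.
- by [].
Qed.

End ComplexDiff.

(** * Cauchy's formula on circles *)

Section CauchyFormula.
Variable R : realType.
Implicit Types (g : R -> R[i]) (G : R[i]^o -> R[i]^o).

Definition cint g : R[i] := rint (fun x => complex.Re (g x)) +i* rint (fun x => complex.Im (g x)).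

Definition ccont g :=
  continuous (fun x => complex.Re (g x)) /\ continuous (fun x => complex.Im (g x)).

Lemma ccontP g : (forall x e, 0 < e -> exists2 r : R, 0 < r & forall h, `|h| < r ->
  nr (g (x + h) - g x : R[i]^o) < e) -> ccont g.
Proof.
move=> gP; split=> x; apply/cvgrPdist_lt => e e0; have [r r0 rP] := gP x e e0;
  apply/nbhs_normP; exists r => // y /=; rewrite distrC => /rP; rewrite [x + _]addrC subrK => H;
  apply: le_lt_trans H; rewrite distrC.
- by apply: le_trans (Re_le_nr _); case: (g y) (g x) => [? ?] [? ?].
- by apply: le_trans (Im_le_nr _); case: (g y) (g x) => [? ?] [? ?].
Qed.

Lemma ccontD g1 g2 : ccont g1 -> ccont g2 -> ccont (fun x => g1 x + g2 x).
Proof.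
move=> [c1 c1'] [c2 c2']; split=> x.
- have -> : (fun x => complex.Re (g1 x + g2 x)) = (fun x => complex.Re (g1 x) + complex.Re (g2 x)).
    by apply/funext => y; case: (g1 y) (g2 y) => [? ?] [? ?].
  by apply: cvgD; [exact: c1|exact: c2].
- have -> : (fun x => complex.Im (g1 x + g2 x)) = (fun x => complex.Im (g1 x) + complex.Im (g2 x)).
    by apply/funext => y; case: (g1 y) (g2 y) => [? ?] [? ?].
  by apply: cvgD; [exact: c1'|exact: c2'].
Qed.

Lemma ccontM g1 g2 : ccont g1 -> ccont g2 -> ccont (fun x => g1 x * g2 x).
Proof.
move=> [c1 c1'] [c2 c2']; split=> x.
- have -> : (fun x => complex.Re (g1 x * g2 x)) =
    (fun x => complex.Re (g1 x) * complex.Re (g2 x) - complex.Im (g1 x) * complex.Im (g2 x)).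
    by apply/funext => y; case: (g1 y) (g2 y) => [? ?] [? ?].
  by apply: cvgB; apply: cvgM; [exact: c1|exact: c2|exact: c1'|exact: c2'].
- have -> : (fun x => complex.Im (g1 x * g2 x)) =
    (fun x => complex.Re (g1 x) * complex.Im (g2 x) + complex.Im (g1 x) * complex.Re (g2 x)).
    apply/funext => y; case: (g1 y) (g2 y) => [? ?] [? ?] /=.
    by rewrite [X in _ + X]mulrC [_ * _ + _]addrC addrC mulrC.
  by apply: cvgD; apply: cvgM; [exact: c1|exact: c2'|exact: c1'|exact: c2].
Qed.

Lemma ccont_cst (c : R[i]) : ccont (fun=> c).
Proof. by split=> x; exact: cvg_cst. Qed.

Lemma cintD g1 g2 : ccont g1 -> ccont g2 ->
  cint (fun x => g1 x + g2 x) = cint g1 + cint g2.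
Proof.
move=> [c1 c1'] [c2 c2']; rewrite /cint.
have -> : (fun x => complex.Re (g1 x + g2 x)) = (fun x => complex.Re (g1 x) + complex.Re (g2 x)).
  by apply/funext => y; case: (g1 y) (g2 y) => [? ?] [? ?].
have -> : (fun x => complex.Im (g1 x + g2 x)) = (fun x => complex.Im (g1 x) + complex.Im (g2 x)).
  by apply/funext => y; case: (g1 y) (g2 y) => [? ?] [? ?].
by rewrite !rintD.
Qed.

Lemma cintZ (c : R[i]) g : ccont g -> cint (fun x => c * g x) = c * cint g.
Proof.
move=> [c1 c2]; rewrite /cint; case: c => a b.
have cZ (k : R) (f : R -> R) : continuous f -> continuous (fun x => k * f x).
  by move=> cf x; apply: cvgMl_tmp; exact: cf.
have -> : (fun x => complex.Re ((a +i* b) * g x)) =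
    (fun x => a * complex.Re (g x) + - b * complex.Im (g x)).
  by apply/funext => y; case: (g y) => [? ?] /=; rewrite mulNr.
have -> : (fun x => complex.Im ((a +i* b) * g x)) =
    (fun x => b * complex.Re (g x) + a * complex.Im (g x)).
  by apply/funext => y; case: (g y) => [? ?] /=; rewrite addrC.
rewrite !rintD ?rintZ//; try exact: cZ.
by apply/eqP; rewrite eq_complex /=; apply/andP; split; apply/eqP; ring.
Qed.

Lemma cint_cst (c : R[i]) : cint (fun=> c) = (pi *+ 2)%:C * c.
Proof.
have rc (k : R) : rint (fun=> k) = (pi *+ 2) * k.
  rewrite -[RHS]subr0 -(mul0r k).
  apply: (@rint_unique _ _ (fun x => x * k)) => [x|x _]; first exact: cvg_cst.
  by apply: is_derive_eq; rewrite scaler0 add0r; exact: mulr1.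
case: c => a b; rewrite /cint /= !rc.
by apply/eqP; rewrite eq_complex /=; apply/andP; split; apply/eqP; ring.
Qed.

(** The real and imaginary parts are estimated separately, whence [4 * pi] in place of the sharp
    [2 * pi]. *)
Lemma cint_le g K : ccont g -> (forall x, nr (g x : R[i]^o) <= K) ->
  nr (cint g : R[i]^o) <= 4 * pi * K.
Proof.
move=> [c1 c2] gK; apply: le_trans (nr_le _) _ => /=.
have := rint_le c1 (fun x => le_trans (Re_le_nr (g x : R[i]^o)) (gK x)).
have := rint_le c2 (fun x => le_trans (Im_le_nr (g x : R[i]^o)) (gK x)).
by move=> h1 h2; apply: le_trans (lerD h2 h1) _; rewrite -mulr_natl; lra.
Qed.

Lemma line_ccont G (u v : R[i]) : continuous G -> ccont (fun x => G (u + x%:C * v)).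
Proof.
move=> cG; apply: ccontP => x e e0.
have [r r0 rP] := (@continuous_nr _ _ _ G (u + x%:C * v)).1 (cG _) e e0.
have v1 : 0 < nr (v : R[i]^o) + 1 by have := nr_ge0 (v : R[i]^o); lra.
exists (r / (nr (v : R[i]^o) + 1)); first by rewrite divr_gt0.
move=> h; rewrite ltr_pdivlMr// => hr.
have -> : u + (x + h)%:C * v = u + x%:C * v + h%:C * v by rewrite rmorphD /=; ring.
apply: rP; rewrite nrM nr_real.
by apply: le_lt_trans hr; rewrite ler_wpM2l// lerDl.
Qed.

Lemma hline (x y : R) : x +i* y = (y *i) + x%:C * 1.
Proof. by apply/eqP; rewrite eq_complex /= !mulr0 !mul0r; apply/andP; split; apply/eqP; ring. Qed.

Lemma vline (x y : R) : x +i* y = x%:C + y%:C * 'i.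
Proof. by apply/eqP; rewrite eq_complex /= !mulr0 !mul0r; apply/andP; split; apply/eqP; ring. Qed.

Lemma hline_ccont G (y : R) : continuous G -> ccont (fun x => G (x +i* y)).
Proof.
by move=> cG; under eq_fun do rewrite hline; exact: line_ccont.
Qed.

Lemma vline_ccont G (x : R) : continuous G -> ccont (fun y => G (x +i* y)).
Proof.
by move=> cG; under eq_fun do rewrite vline; exact: line_ccont.
Qed.

(** The form [Re (G dz) = Re G dx - Im G dy] is closed by the Cauchy-Riemann equations. On the
    rectangle of width one period the vertical edges contribute equally, so the horizontal ones do
    too. *)
Lemma rint_Re_hline G y : (forall z, differentiable G z) ->
  (forall z, G (z + (pi *+ 2)%:C) = G z) -> 0 < y ->
  rint (fun x => complex.Re (G (x +i* y))) = rint (fun x => complex.Re (G (x +i* 0))).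
Proof.
move=> dG perG y0.
have cG : continuous G by move=> z; apply: differentiable_continuous.
pose P (x y : R) := complex.Re (G (x +i* y)).
pose Q (x y : R) := - complex.Im (G (x +i* y)).
pose A (x y : R) := primitive (P^~ y) x.
pose B (x y : R) := primitive (Q x) y.
have cP t : continuous (P^~ t) by exact: (hline_ccont _ cG).1.
have cQ t : continuous (Q t).
  by move=> s; apply: cvgN; exact: (vline_ccont _ cG).2.
have /= := @closed_form_mixed_diff R A B P Q 0 (pi *+ 2) 0 y _ y0 _ _ _.
have -> : mixed_diff B 0 (pi *+ 2) 0 y = 0.
  rewrite /mixed_diff /B (_ : Q (pi *+ 2) = Q 0); first by ring.
  apply/funext => t; rewrite /Q; congr (- complex.Im _).
  by rewrite -(perG (0 +i* t)); congr G; apply/eqP; rewrite eq_complex /= add0r addr0 !eqxx.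
have -> : mixed_diff A 0 (pi *+ 2) 0 y = rint (P^~ y) - rint (P^~ 0).
  by rewrite /mixed_diff /A /rint; ring.
move=> H; apply/eqP; rewrite -subr_eq0; apply/eqP; apply: H.
- by rewrite pmulrn_rgt0// pi_gt0.
- by move=> x t /andP[x0 _] _; apply: is_derive_primitive; [exact: cP|lra].
- by move=> x t _ /andP[t0 _]; apply: is_derive_primitive; [exact: cQ|lra].
- move=> x0 t0; pose z0 : R[i]^o := x0 +i* t0; have dz := dG z0.
  set c := 'd G z0 1.
  (* These are the coefficients of [Re (h * c)] and [- Im (h * c)] in the components of [h]; that
     [- Im c] occurs in both is the Cauchy-Riemann equation. *)
  exists (complex.Re c), (- complex.Im c), (- complex.Re c) => e e0.
  have [r r0 rP] := diff_nr dz e0; exists (r / 2); first by rewrite divr_gt0.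
  move=> x t xr tr; pose h : R[i]^o := (x - x0) +i* (t - t0).
  have hle : nr h <= `|x - x0| + `|t - t0| by exact: nr_le.
  have /rP : nr h < r by lra.
  have -> : z0 + h = x +i* t.
    by apply/eqP; rewrite eq_complex /= ![_ + (_ - _)]addrC !subrK !eqxx.
  have -> : 'd G z0 h = h * c.
    by rewrite -[in LHS](mulr1 h) -[h * 1]/(h *: 1) linearZ.
  move=> Gh.
  have {}Gh : nr (G (x +i* t) - G z0 - h * c) <= e * (`|x - x0| + `|t - t0|).
    by apply: le_trans Gh _; rewrite ler_pM2l.
  split; [apply: le_trans (le_trans (Re_le_nr _) Gh)|apply: le_trans (le_trans (Im_le_nr _) Gh)];
  rewrite /P /Q /h -/z0; case: (G (x +i* t)) (G z0) c {Gh} => [a b] [a' b'] [c d] /=.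
  + by rewrite le_eqVlt; apply/orP; left; apply/eqP; congr (`|_|); ring.
  + by rewrite -normrN le_eqVlt; apply/orP; left; apply/eqP; congr (`|_|); ring.
Qed.

Lemma cint_hline G y : (forall z, differentiable G z) ->
  (forall z, G (z + (pi *+ 2)%:C) = G z) -> 0 < y ->
  cint (fun x => G (x +i* y)) = cint (fun x => G (x +i* 0)).
Proof.
move=> dG perG y0; rewrite /cint; congr (_ +i* _); first exact: rint_Re_hline.
(* The imaginary part of [G] is the real part of [- 'i *: G], which is again entire and periodic. *)
pose G' : R[i]^o -> R[i]^o := fun z => - 'i *: G z.
have ImE (z : R[i]) : complex.Im (G z) = complex.Re (G' z).
  by rewrite /G'; case: (G z) => a b; rewrite /GRing.scale /= ; ring.
under eq_fun do rewrite ImE.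
under [in RHS]eq_fun do rewrite ImE.
apply: rint_Re_hline; [|by move=> z; rewrite /G' perG|exact: y0].
by move=> z; apply: differentiableZ; exact: dG.
Qed.

Definition circ (x : R) : R[i] := cexp (0 +i* x).

Lemma nr_circ x : nr (circ x : R[i]^o) = 1.
Proof. by rewrite nr_cexp /= expR0. Qed.

(* With [G z = (F (W + e^{iz} v) - F W) e^{-iz}] the mean of [G] over a period
   does not depend on [Im z], and tends to ['d F W v] as [Im z] grows. *)
Lemma cauchy_formula (V : normedModType R[i]) (F : V -> R[i]^o) (W v : V) :
  (forall x, differentiable F x) ->
  cint (fun x => (F (W + circ x *: v) - F W) * (circ x)^-1) = (pi *+ 2)%:C * 'd F W v.
Proof.
move=> dF.
pose E (z : R[i]^o) : R[i]^o := cexp ('i *: z).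
have dE z : differentiable E z.
  have d1 : differentiable (fun z : R[i]^o => 'i *: z : R[i]^o) z by exact: differentiableZ.
  exact: (differentiable_comp d1 (differentiable_cexp _)).
pose G (z : R[i]^o) : R[i]^o := (F (W + E z *: v) - F W) * (E z)^-1.
have dG z : differentiable G z.
  apply: differentiableM; last by apply: differentiableV => //; exact: cexp_neq0.
  apply: differentiableB => //.
  have d1 : differentiable (fun z : R[i]^o => W + E z *: v) z.
    by apply: differentiableD => //; exact: differentiableZl.
  exact: (differentiable_comp d1 (dF _)).
have Eper z : E (z + (pi *+ 2)%:C) = E z.
  rewrite /E scalerDr cexpD; rewrite -[RHS]mulr1; congr (_ * _).
  have -> : 'i *: ((pi *+ 2)%:C : R[i]^o) = 0 +i* (pi *+ 2).
    by apply/eqP; rewrite eq_complex /= !mul0r mulr0 mul1r subrr add0r !eqxx.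
  by rewrite /cexp /= expR0 !mul1r cos2pi sin2pi.
have Gper z : G (z + (pi *+ 2)%:C) = G z by rewrite /G Eper.
have cG : continuous G by move=> z; apply: differentiable_continuous.
have Ehline x : E (x +i* 0) = circ x.
  rewrite /E /circ; congr cexp; apply/eqP.
  by rewrite eq_complex /= !mul0r mulr0 mul1r subrr add0r !eqxx.
have -> : (fun x => (F (W + circ x *: v) - F W) * (circ x)^-1) = (fun x => G (x +i* 0)).
  by apply/funext => x; rewrite /G Ehline.
rewrite -cint_cst; apply/eqP; rewrite -subr_eq0; apply/eqP/(@nr_eq0 _ R[i]^o).
apply/eqP; rewrite eq_le nr_ge0 andbT; apply/ler_addgt0Pr => e e0; rewrite add0r.
set c := 'd F W v.
(* Chosen so that [4 * pi * (e' * (nr v + 1)) = e]; the [+ 1] covers [v = 0]. *)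
pose e' := e / (4 * pi * (nr v + 1)).
have pv : 0 < 4 * pi * (nr v + 1).
  by rewrite !mulr_gt0 ?pi_gt0// ltr_wpDl ?nr_ge0.
have e'0 : 0 < e' by rewrite divr_gt0.
have [r r0 rP] := diff_nr (dF W) e'0.
(* The height must bring [E z *: v] into the ball where the expansion at [W] is valid; the
   inequality [1 + k <= expR k] provides an explicit one. *)
have [y y0 yr] : exists2 y, 0 < y & expR (- y) * nr v < r.
  pose k := (nr v + 1) / r.
  have k0 : 0 < k by rewrite divr_gt0// ltr_wpDl ?nr_ge0.
  exists k => //; rewrite expRN mulrC ltr_pdivrMr ?expR_gt0//.
  have : 1 + k <= expR k by apply: expR_ge1Dx.
  move=> H; apply: lt_le_trans (ler_wpM2l (ltW r0) H).
  by rewrite mulrDr mulr1 /k mulrCA divff ?gt_eqF// mulr1; lra.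
rewrite -(cint_hline dG Gper y0).
have -> : cint (fun x => G (x +i* y)) - cint (fun=> c) = cint (fun x => G (x +i* y) + - c).
  rewrite cintD ?cint_cst ?mulrN//; first exact: hline_ccont.
  exact: ccont_cst.
have -> : e = 4 * pi * (e' * (nr v + 1)).
  by rewrite mulrCA /e' divfK// gt_eqF.
apply: cint_le => [|x].
  by apply: ccontD; [exact: hline_ccont|exact: ccont_cst].
have nE : nr (E (x +i* y)) = expR (- y).
  by rewrite /E nr_cexp; congr expR; rewrite /GRing.scale /= mul0r mul1r sub0r.
have Ev : nr (E (x +i* y) *: v) < r by rewrite nrZ nE.
have E0 : E (x +i* y) != 0 by exact: cexp_neq0.
(* The deviation of [G] from [c] is the first-order remainder of [F] at [W] for the increment
   [E z *: v], divided by [E z]. Both the increment and the divisor scale with [expR (- y)], so the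
   quotient is bounded by [e' * nr v]. *)
have -> : G (x +i* y) + - c =
   (F (W + E (x +i* y) *: v) - F W - 'd F W (E (x +i* y) *: v)) * (E (x +i* y))^-1.
  have -> : 'd F W (E (x +i* y) *: v) = c * E (x +i* y).
    by rewrite mulrC; exact: linearZ.
  by rewrite /G [RHS]mulrBl mulfK.
rewrite nrM nrV nE ler_pdivrMr ?expR_gt0//.
apply: le_trans (rP _ Ev) _; rewrite nrZ nE -[leRHS]mulrA; apply: ler_wpM2l; first exact: ltW.
by rewrite mulrC ler_wpM2r ?expR_ge0// lerDl.
Qed.

End CauchyFormula.

(** * Derivatives of holomorphic functions are holomorphic *)

Section DerivativeHolomorphic.
Variable R : realType.

Lemma is_derive_expand (f : R -> R) (t d : R) :
  (forall e, 0 < e -> exists2 r, 0 < r &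
     forall s, `|s| < r -> `|f (t + s) - f t - s * d| <= e * `|s|) ->
  is_derive t 1 f d.
Proof.
move=> fP.
have [|||df1 df2] := @expand_diff R R^o R^o f t (d \*o (@idfun R^o)) (`|d| + 1).
- by rewrite ltr_wpDl.
- by move=> h; rewrite /= normrM ler_wpM2r// lerDl.
- by move=> e /fP[r r0 rP]; exists r => // h /rP; rewrite mulrC.
split; first exact/derivable1_diffP.
by rewrite deriveE// df2 /= mulr1.
Qed.

Variable V : normedModType R[i].
Variable F : V -> R[i]^o.
Hypothesis dF : forall x, differentiable F x.
Implicit Types Z W v h : V.

(** The real mean value bound is applied to the two components of [F (Z + t h) - t c], which
    accounts for the factor [2]. *)
Lemma mvt_complex Z h (c : R[i]^o) K :
  (forall t : R, 0 <= t <= 1 -> nr ('d F (Z + t%:C *: h) h - c : R[i]^o) <= K) ->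
  nr (F (Z + h) - F Z - c : R[i]^o) <= 2 * K.
Proof.
move=> hK.
pose g (t : R) : R[i]^o := F (Z + t%:C *: h) - t%:C * c.
have gP t e : 0 < e -> exists2 r, 0 < r & forall s : R, `|s| < r ->
   nr (g (t + s) - g t - s%:C * ('d F (Z + t%:C *: h) h - c) : R[i]^o) <= e * `|s|.
  move=> e0; have h1 : 0 < nr h + 1 by rewrite ltr_wpDl ?nr_ge0.
  have e1 : 0 < e / (nr h + 1) by rewrite divr_gt0.
  have [r r0 rP] := diff_nr (dF (Z + t%:C *: h)) e1.
  exists (r / (nr h + 1)); first by rewrite divr_gt0.
  move=> s; rewrite ltr_pdivlMr// => sr.
  have shE : nr (s%:C *: h) = `|s| * nr h by rewrite nrZ nr_real.
  have /rP : nr (s%:C *: h) < r.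
    by rewrite shE; apply: le_lt_trans sr; rewrite ler_wpM2l// lerDl.
  have -> : 'd F (Z + t%:C *: h) (s%:C *: h) = s%:C * 'd F (Z + t%:C *: h) h.
    exact: linearZ.
  have -> : g (t + s) - g t - s%:C * ('d F (Z + t%:C *: h) h - c) =
      F (Z + t%:C *: h + s%:C *: h) - F (Z + t%:C *: h) - s%:C * 'd F (Z + t%:C *: h) h.
    by rewrite /g rmorphD /= scalerDl addrA; ring.
  move=> H; apply: le_trans H _; rewrite shE mulrAC ler_pdivrMr//.
  by rewrite -[leRHS]mulrA ler_pM2l// ler_wpM2l// lerDl.
have E : F (Z + h) - F Z - c = g 1 - g 0.
  by rewrite /g !scale1r !scale0r addr0 mul1r mul0r subr0 addrAC.
rewrite E; apply: le_trans (nr_le _) _; rewrite mulr_natl mulr2n.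
apply: lerD.
- rewrite (_ : complex.Re (g 1 - g 0) = complex.Re (g 1) - complex.Re (g 0)); last first.
    by case: (g 1) (g 0) => [? ?] [? ?].
  rewrite -[K]mulr1 -[X in K * X]subr0.
  pose f (t : R) := complex.Re (g t).
  pose df (t : R) := complex.Re ('d F (Z + t%:C *: h) h - c).
  apply: (@mvt_bound R f df 0 1 K).
  + by [].
  + move=> t _; apply: is_derive_expand => e e0; have [r r0 rP] := gP t e e0.
    exists r => // s /rP; apply: le_trans; apply: le_trans (Re_le_nr _).
    rewrite le_eqVlt; apply/orP; left; apply/eqP; congr (`|_|); rewrite /f /df.
    case: (g (t + s)) (g t) (_ - c) => [? ?] [? ?] [? ?] /=; ring.
  + by move=> t /hK; apply: le_trans; exact: Re_le_nr.
- rewrite (_ : complex.Im (g 1 - g 0) = complex.Im (g 1) - complex.Im (g 0)); last first.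
    by case: (g 1) (g 0) => [? ?] [? ?].
  rewrite -[K]mulr1 -[X in K * X]subr0.
  pose f (t : R) := complex.Im (g t).
  pose df (t : R) := complex.Im ('d F (Z + t%:C *: h) h - c).
  apply: (@mvt_bound R f df 0 1 K).
  + by [].
  + move=> t _; apply: is_derive_expand => e e0; have [r r0 rP] := gP t e e0.
    exists r => // s /rP; apply: le_trans; apply: le_trans (Im_le_nr _).
    rewrite le_eqVlt; apply/orP; left; apply/eqP; congr (`|_|); rewrite /f /df.
    case: (g (t + s)) (g t) (_ - c) => [? ?] [? ?] [? ?] /=; ring.
  + by move=> t /hK; apply: le_trans; exact: Im_le_nr.
Qed.

Lemma circ_expi x : circ x = cexp ('i *: (0 + x%:C * 1 : R[i]^o)).
Proof.
congr cexp; apply/eqP; rewrite eq_complex /=.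
by rewrite !(mul0r, mulr0, mul1r, mulr1, add0r, addr0, subr0, oppr0) !eqxx.
Qed.

Lemma circV_expi x : (circ x)^-1 = cexp ('i *: (0 + x%:C * (-1) : R[i]^o)).
Proof.
rewrite circ_expi -cexpN; congr cexp.
by rewrite !add0r mulr1 mulrN1 scalerN.
Qed.

Lemma continuous_expi : continuous (fun z : R[i]^o => cexp ('i *: z) : R[i]^o).
Proof.
move=> z; apply: differentiable_continuous.
have d1 : differentiable (fun z : R[i]^o => 'i *: z : R[i]^o) z by exact: differentiableZ.
exact: (differentiable_comp d1 (differentiable_cexp _)).
Qed.

Lemma circV_ccont : ccont (fun x : R => (circ x)^-1).
Proof.
rewrite (_ : (fun x => _) = fun x : R => cexp ('i *: (0 + x%:C * (-1) : R[i]^o))).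
  exact: (line_ccont 0 (-1) continuous_expi).
by apply/funext => x; rewrite circV_expi.
Qed.

Lemma circle_ccont (H : V -> R[i]^o) W v :
  (forall x, {for W + circ x *: v, continuous H}) ->
  ccont (fun x => H (W + circ x *: v)).
Proof.
move=> cH; apply: ccontP => x e e0.
have [r r0 rP] := (@continuous_nr _ _ _ _ _).1 (cH x) e e0.
have v1 : 0 < nr v + 1 by rewrite ltr_wpDl ?nr_ge0.
have [r' r'0 r'P] := (@continuous_nr R R[i]^o R[i]^o (fun z => cexp ('i *: z))
  (0 + x%:C * 1)).1 (@continuous_expi _) _ (divr_gt0 r0 v1).
exists r' => // s sr.
have := r'P s%:C; rewrite nr_real => /(_ sr).
have -> : 0 + x%:C * 1 + s%:C = 0 + (x + s)%:C * 1 :> R[i] by rewrite rmorphD /=; ring.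
rewrite -!circ_expi ltr_pdivlMr// => H1.
have -> : W + circ (x + s) *: v = W + circ x *: v + (circ (x + s) - circ x) *: v.
  by rewrite -addrA -scalerDl [circ x + _]addrC subrK.
apply: rP; rewrite nrZ; apply: le_lt_trans H1.
by rewrite ler_wpM2l ?nr_ge0// lerDl.
Qed.

(** By homogeneity a bound on one ball is a bound everywhere. *)
Lemma scale_bound (T : V -> R[i]^o) r K : 0 < r ->
  (forall k v, T (k *: v) = k *: T v) ->
  (forall v, nr v <= r -> nr (T v) <= K) -> forall v, nr (T v) <= K / r * nr v.
Proof.
move=> r0 TZ TK v; have [v0|v0] := eqVneq (nr v) 0.
  have := TZ 0 v; rewrite !scale0r (nr_eq0 v0) => ->.
  by rewrite !nr0 mulr0.
have vp : 0 < nr v by rewrite lt_neqAle eq_sym v0 nr_ge0.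
pose k : R := r / nr v.
have k0 : 0 < k by rewrite divr_gt0.
have -> : T v = k^-1%:C *: T (k%:C *: v).
  rewrite TZ scalerA -rmorphM /= mulVf ?gt_eqF// scale1r //.
rewrite nrZ nr_real gtr0_norm ?invr_gt0//.
have -> : K / r * nr v = k^-1 * K by rewrite /k invf_div; ring.
apply: ler_wpM2l; first by rewrite invr_ge0 ltW.
apply: TK.
by rewrite nrZ nr_real gtr0_norm// /k divfK ?lexx.
Qed.

Lemma cauchy_ccont Z v : ccont (fun x => (F (Z + circ x *: v) - F Z) * (circ x)^-1).
Proof.
apply: ccontM circV_ccont; apply: ccontD; last exact: ccont_cst.
by apply: circle_ccont => x; exact: differentiable_continuous.
Qed.

(** Turns Cauchy's formula into an estimate of a derivative; the [2] is the constant [4 * pi] of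
    [cint_le] divided by the period. *)
Lemma cint_bound (g : R -> R[i]) (c : R[i]) K : ccont g ->
  cint g = (pi *+ 2)%:C * c -> (forall x, nr (g x : R[i]^o) <= K) ->
  nr (c : R[i]^o) <= 2 * K.
Proof.
move=> cg gc gK; have := cint_le cg gK.
have p2 : 0 < pi *+ 2 :> R by rewrite pmulrn_rgt0 ?pi_gt0.
rewrite gc nrM nr_real gtr0_norm//.
have -> : 4 * pi * K = pi *+ 2 * (2 * K) by rewrite -mulr_natl; ring.
by rewrite ler_pM2l.
Qed.

Section LocalBounds.
Variables (W : V) (r M : R).
Hypothesis r0 : 0 < r.
Hypothesis FM : forall h, nr h < 4 * r -> nr (F (W + h)) <= M.

(** Radii are counted in units of [r]. Each use of Cauchy's formula on circles of radius at most [r]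
    costs one unit: [F] is bounded within [4], its differential is bounded within [3] and Lipschitz
    within [2]. *)
Let near Z (k : R) := nr (Z - W) < k * r.

Let FMn Z : near Z 4 -> nr (F Z) <= M.
Proof. by move=> /FM; rewrite addrC subrK. Qed.

Let nearD Z h k l : near Z k -> nr h <= l * r -> near (Z + h) (k + l).
Proof.
move=> Zk hl; rewrite /near addrAC mulrDl.
by apply: le_lt_trans (nrD _ _) _; rewrite ltr_leD.
Qed.

Let near_circ Z x v k : near Z k -> nr v <= r -> near (Z + circ x *: v) (k + 1).
Proof. by move=> Zk vr; apply: nearD; rewrite // nrZ nr_circ !mul1r. Qed.

Let nearW k l Z : k <= l -> near Z k -> near Z l.
Proof.
by move=> kl; rewrite /near => H; apply: lt_le_trans H _; rewrite ler_pM2r.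
Qed.

Let C1 := 4 * M / r.

Let M0 : 0 <= M.
Proof. by apply: le_trans (FM (h := 0) _); rewrite ?nr_ge0// nr0 mulr_gt0. Qed.

Let C10 : 0 <= C1. Proof. by rewrite divr_ge0 ?mulr_ge0// ltW. Qed.

Lemma local_diff_bound Z v : near Z 3 -> nr ('d F Z v) <= C1 * nr v.
Proof.
move=> Z3; apply: scale_bound => // [k h|h hr]; first exact: linearZ.
rewrite (_ : 4 * M = 2 * (2 * M)); last by ring.
apply: cint_bound (cauchy_ccont Z h) (cauchy_formula Z h dF) _ => x.
rewrite nrM nrV nr_circ invr1 mulr1; apply: le_trans (nrB _ _) _.
rewrite mulr_natl mulr2n lerD ?FMn//; last by apply: nearW Z3; lra.
by apply: nearW (near_circ x Z3 hr); lra.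
Qed.

Let near_segment Z h k (t : R) : near Z k -> near (Z + h) k -> 0 <= t <= 1 ->
  near (Z + t%:C *: h) k.
Proof.
rewrite /near => h1 h2 /andP[t0 t1].
have -> : Z + t%:C *: h - W = (1 - t)%:C *: (Z - W) + t%:C *: (Z + h - W).
  rewrite [LHS]addrAC [Z + h - W]addrAC; move: (Z - W) => u.
  by rewrite [X in _ = _ + X]scalerDr addrA -scalerDl -rmorphD /= subrK scale1r.
apply: le_lt_trans (nrD _ _) _; rewrite !nrZ !nr_real !ger0_norm ?subr_ge0//.
have [->|t'] := eqVneq t 0; first by rewrite subr0 mul0r mul1r addr0.
have tp : 0 < t by rewrite lt_neqAle eq_sym t' t0.
have -> : k * r = (1 - t) * (k * r) + t * (k * r) by ring.
by apply: ler_ltD; [rewrite ler_wpM2l ?subr_ge0// ltW|rewrite ltr_pM2l].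
Qed.

Lemma local_lipschitz Z h : near Z 3 -> near (Z + h) 3 ->
  nr (F (Z + h) - F Z) <= 2 * C1 * nr h.
Proof.
move=> Z3 Zh3; rewrite -[F (Z + h) - F Z]subr0 -mulrA; apply: mvt_complex => t t01.
by rewrite subr0; apply: local_diff_bound; exact: near_segment.
Qed.

Let C2 := 8 * C1 / r.

(** Subtracting Cauchy's formulas at [Z + h] and [Z] and regrouping leaves two increments of [F]
    along [h], one on the circle and one at its centre. Each is controlled by [local_lipschitz]. *)
Lemma local_diff_lipschitz Z h v : near Z 2 -> near (Z + h) 2 ->
  nr ('d F (Z + h) v - 'd F Z v) <= C2 * nr h * nr v.
Proof.
move=> Z2 Zh2.
have Z3 : near Z 3 by apply: nearW Z2; lra.
have Zh3 : near (Z + h) 3 by apply: nearW Zh2; lra.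
have -> : C2 * nr h * nr v = 8 * C1 * nr h / r * nr v by rewrite /C2; ring.
apply: (@scale_bound (fun v => 'd F (Z + h) v - 'd F Z v)) => // {v} [k v|v vr].
  have dZ X : 'd F X (k *: v) = k *: 'd F X v by exact: linearZ.
  by rewrite !dZ scalerBr.
have -> : 8 * C1 * nr h = 2 * (2 * C1 * nr h + 2 * C1 * nr h) by ring.
pose g Z x := (F (Z + circ x *: v) - F Z) * (circ x)^-1.
have cg := cauchy_ccont.
apply: (@cint_bound (fun x => g (Z + h) x + (-1) * g Z x)).
- apply: ccontD; first exact: cg.
  by apply: ccontM; [exact: ccont_cst|exact: cg].
- rewrite cintD; [|exact: cg|by apply: ccontM; [exact: ccont_cst|exact: cg]].
  rewrite cintZ; last exact: cg.
  by rewrite !cauchy_formula// mulN1r mulrBr.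
- move=> x; rewrite /g.
  have -> : (F (Z + h + circ x *: v) - F (Z + h)) / circ x +
      -1 * ((F (Z + circ x *: v) - F Z) / circ x)
    = ((F (Z + circ x *: v + h) - F (Z + circ x *: v)) - (F (Z + h) - F Z)) / circ x.
    by rewrite [Z + h + _]addrAC; ring.
  rewrite nrM nrV nr_circ invr1 mulr1; apply: le_trans (nrB _ _) _.
  apply: lerD; apply: local_lipschitz => //.
    by apply: nearW (near_circ x Z2 vr); lra.
  by rewrite addrAC; apply: nearW (near_circ x Zh2 vr); lra.
Qed.

Let C20 : 0 <= C2.
Proof. by apply: divr_ge0; [apply: mulr_ge0|exact: ltW]. Qed.

(** The remainder is quadratic with a constant uniform on the ball, which is what permits
    differentiation under the integral sign. *)
Lemma local_taylor Z h : near Z 2 -> near (Z + h) 2 ->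
  nr (F (Z + h) - F Z - 'd F Z h) <= 2 * C2 * nr h ^+ 2.
Proof.
move=> Z2 Zh2; rewrite -mulrA; apply: mvt_complex => t t01.
apply: le_trans (local_diff_lipschitz _ Z2 (near_segment Z2 Zh2 t01)) _.
rewrite expr2 mulrA ler_wpM2r ?nr_ge0// ler_wpM2l//.
by rewrite nrZ nr_real ger0_norm; case/andP: t01 => // t0 t1; rewrite ler_piMl ?nr_ge0.
Qed.

Let near_center k : 0 < k -> near W k.
Proof. by move=> k0; rewrite /near subrr nr0 mulr_gt0. Qed.

(** Cauchy's formula for ['d F W v] is differentiated under the integral in [W]. *)
Lemma local_diff_differentiable v : nr v < r -> differentiable (fun Z => 'd F Z v : R[i]^o) W.
Proof.
move=> /ltW vr.
pose p2 : R[i] := (pi *+ 2)%:C.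
have p20 : p2 != 0.
  by rewrite /p2; apply/eqP => -[] /eqP; rewrite gt_eqF// pmulrn_rgt0 ?pi_gt0.
have cd h : ccont (fun x => 'd F (W + circ x *: v) h).
  apply: (@circle_ccont (fun Z => 'd F Z h)) => x; apply/continuous_nr => e e0.
  have h1 : 0 < C2 * nr h + 1 by rewrite ltr_wpDl// mulr_ge0// nr_ge0.
  have near1 : near (W + circ x *: v) (1 / 2 + 1).
    by apply: near_circ => //; apply: near_center; lra.
  exists (Num.min (r / 2) (e / (C2 * nr h + 1))); first by rewrite lt_min !divr_gt0.
  move=> k; rewrite lt_min => /andP[kr ke].
  have near2 : near (W + circ x *: v) 2 by apply: nearW near1; lra.
  have near3 : near (W + circ x *: v + k) 2.
    by rewrite (_ : 2 = 1 / 2 + 1 + 1 / 2); [apply: nearD => //; lra|field].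
  apply: le_lt_trans (local_diff_lipschitz _ near2 near3) _.
  move: ke; rewrite ltr_pdivlMr//; apply: le_lt_trans.
  by rewrite mulrAC mulrC ler_wpM2l ?nr_ge0// lerDl.
(* The derivative of the Cauchy integrand with respect to its centre, in the direction [h]; its mean
   over the period is the candidate differential [L h]. *)
pose g h x := ('d F (W + circ x *: v) h + (-1) * 'd F W h) * (circ x)^-1.
have cg h : ccont (g h).
  by apply: ccontM circV_ccont; apply: ccontD => //; exact: ccont_cst.
pose L (h : V) : R[i]^o := p2^-1 * cint (g h).
have Llin : linear L.
  move=> k h1 h2; rewrite /L.
  have -> : g (k *: h1 + h2) = fun x => k * g h1 x + g h2 x.
    apply/funext => x; rewrite /g !linearD !linearZ /=.
    by rewrite /GRing.scale /=; ring.
  rewrite cintD//; last by apply: ccontM => //; exact: ccont_cst.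
  by rewrite cintZ// -[k *: (_ * _)]/(k * (_ * _)); ring.
pose Ll : {linear V -> R[i]^o} := HB.pack L (GRing.isLinear.Build _ _ _ _ _ Llin).
have Lg h : cint (g h) = p2 * L h by rewrite /L mulrA mulfV// mul1r.
have K1 : 0 < 4 * C1 + 1 by rewrite ltr_wpDl// mulr_ge0.
have [||//] := @nr_diff _ _ _ (fun Z => 'd F Z v : R[i]^o) W Ll (4 * C1 + 1) K1.
- move=> h.
  have : nr (L h) <= 2 * (C1 * nr h + C1 * nr h).
    apply: cint_bound (cg h) (Lg h) _ => x.
    rewrite /g nrM nrV nr_circ invr1 mulr1 mulN1r; apply: le_trans (nrB _ _) _.
    apply: lerD; apply: local_diff_bound; last by apply: near_center; lra.
    by rewrite (_ : 3 = 2 + 1); [apply: near_circ => //; apply: near_center; lra|ring].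
  move=> H; apply: le_trans H _; rewrite mulrDl mul1r.
  by have := nr_ge0 h; lra.
- move=> e e0; have h1 : 0 < 8 * C2 + 1 by rewrite ltr_wpDl// mulr_ge0.
  (* The first radius keeps the circles around [W + h] within [2]. The second absorbs the constant
     of the remainder, which is at most [8 * C2 * nr h ^+ 2]. *)
  exists (Num.min (r / 2) (e / (8 * C2 + 1))); first by rewrite lt_min !divr_gt0.
  move=> h; rewrite lt_min => /andP[hr]; rewrite ltr_pdivlMr// => he.
  have cc Z := cauchy_ccont Z v.
  pose G Z x := (F (Z + circ x *: v) - F Z) * (circ x)^-1.
  (* The integral of [D] is [2 pi] times the remainder to be estimated. Pointwise, [D] is a
     difference of two Taylor remainders of [F], at [W + circ x *: v] and at [W]. *)
  pose D x := G (W + h) x + ((-1) * G W x + (-1) * g h x).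
  have near1 : near W 2 by apply: near_center; lra.
  have near2 : near (W + h) (1 / 2 + 1 / 2).
    by apply: nearD; [apply: near_center|]; lra.
  have near3 x : near (W + circ x *: v) 2.
    by apply: nearW (near_circ x (@near_center (1 / 2) _) vr); lra.
  have near4 x : near (W + circ x *: v + h) 2.
    by rewrite addrAC; apply: nearW (near_circ x near2 vr); lra.
  have cM (g' : R -> R[i]) : ccont g' -> ccont (fun x => -1 * g' x).
    by move=> ?; apply: ccontM => //; exact: ccont_cst.
  have : nr ('d F (W + h) v - 'd F W v - L h : R[i]^o) <=
      2 * (2 * C2 * nr h ^+ 2 + 2 * C2 * nr h ^+ 2).
    apply: (@cint_bound D).
    + by apply: ccontD; [exact: cc|apply: ccontD; apply: cM; [exact: cc|exact: cg]].
    + rewrite /D cintD; [|exact: cc|apply: ccontD; apply: cM; [exact: cc|exact: cg]].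
      rewrite cintD; [|apply: cM; exact: cc|apply: cM; exact: cg].
      rewrite !cintZ; [|exact: cg|exact: cc].
      by rewrite !cauchy_formula// Lg -/p2; ring.
    + move=> x; rewrite /D /G /g.
      set a := F _; set b := F (W + h); set c := F (W + _); set d := F W.
      set p := 'd F _ h; set q := 'd F _ h.
      have -> : (a - b) / circ x + (-1 * ((c - d) / circ x) + -1 * ((p + -1 * q) / circ x))
        = ((a - c - p) - (b - d - q)) / circ x by ring.
      rewrite nrM nrV nr_circ invr1 mulr1; apply: le_trans (nrB _ _) _.
      apply: lerD; last by apply: local_taylor => //; apply: nearW near2; lra.
      by rewrite /a [W + h + _]addrAC; exact: local_taylor (near3 x) (near4 x).
  move=> H; apply: le_trans H _.
  have -> : 2 * (2 * C2 * nr h ^+ 2 + 2 * C2 * nr h ^+ 2) = nr h * (8 * C2) * nr h by ring.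
  rewrite ler_wpM2r ?nr_ge0//; apply: le_trans (ltW he).
  by rewrite ler_wpM2l ?nr_ge0// lerDl.
Qed.

End LocalBounds.

(** Continuity at [W] supplies the local bound [nr (F W) + 1], and linearity in [v] allows [v] to be
    scaled into the small ball. *)
Theorem differentiable_diff v W : differentiable (fun Z => 'd F Z v : R[i]^o) W.
Proof.
have [r r0 rP] := (@continuous_nr _ _ _ _ _).1 (differentiable_continuous (dF W)) 1 ltr01.
have r4 : 0 < r / 4 by rewrite divr_gt0.
have FM h : nr h < 4 * (r / 4) -> nr (F (W + h)) <= nr (F W) + 1.
  rewrite mulrC divfK// => /rP H.
  rewrite -[F (W + h)](subrK (F W)) addrC; apply: le_trans (nrD _ _) _.
  by rewrite lerD2l ltW.
pose k : R := r / 4 / (nr v + 1).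
have v1 : 0 < nr v + 1 by rewrite ltr_wpDl ?nr_ge0.
have k0 : 0 < k by rewrite divr_gt0.
have kv : nr (k%:C *: v) < r / 4.
  by rewrite nrZ nr_real gtr0_norm// /k mulrAC ltr_pdivrMr// ltr_pM2l// ltrDl.
have -> : (fun Z => 'd F Z v : R[i]^o) = k%:C^-1 \*: (fun Z => 'd F Z (k%:C *: v) : R[i]^o).
  apply/funext => Z /=; rewrite linearZ /= scalerA mulVf ?scale1r//.
  by apply/eqP => -[] /eqP; rewrite gt_eqF.
by apply: differentiableZ; exact: local_diff_differentiable r4 FM _ kv.
Qed.

Lemma differentiable_derive v W : differentiable ('D_v F : V -> R[i]^o) W.
Proof.
rewrite (_ : 'D_v F = fun Z => 'd F Z v : R[i]^o); first exact: differentiable_diff.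
by apply/funext => Z; rewrite deriveE.
Qed.

End DerivativeHolomorphic.

(** * Smoothness of holomorphic functions along real-linear maps *)

Section RealComposition.
Variables (R : realType) (V : normedModType R) (U : normedModType R[i]).
Variables (iota : V -> U) (k : R).
Hypothesis k0 : 0 < k.
Hypothesis iota_lin : forall a u v, iota (a *: u + v) = a%:C *: iota u + iota v.
Hypothesis iota_bound : forall v, nr (iota v) <= k * `|v|.
(** Stands for the real or the imaginary part. *)
Variable p : R[i] -> R.
Hypothesis p_lin : forall a z w, p (a%:C * z + w) = a * p z + p w.
Hypothesis p_bound : forall z : R[i]^o, `|p z| <= nr z.

Lemma real_comp_differentiable (F : U -> R[i]^o) x : differentiable F (iota x) ->
  differentiable (fun v => p (F (iota v)) : R) x /\
  forall v, 'D_v (fun v => p (F (iota v)) : R) x = p ('D_(iota v) F (iota x)).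
Proof.
move=> dF.
have iotaD u v : iota (u + v) = iota u + iota v.
  by rewrite -[u]scale1r iota_lin !scale1r.
have pB z w : p (z - w) = p z - p w.
  have := p_lin (-1) w z; rewrite rmorphN1 !mulN1r addrC => ->.
  by rewrite addrC.
have Llin : linear (fun v => p ('d F (iota x) (iota v)) : R^o).
  move=> a u v; rewrite iota_lin -[RHS]p_lin; congr p.
  exact: linearP.
pose L : {linear V -> R^o} := HB.pack (fun v => p ('d F (iota x) (iota v)) : R^o)
  (GRing.isLinear.Build _ _ _ _ _ Llin).
have [c c0 cP] := diff_bounded dF.
have [|||d1 d2] := @expand_diff R V R^o (fun v => p (F (iota v))) x L (c * k).
- by rewrite mulr_gt0.
- move=> h; apply: le_trans (p_bound _) _; apply: le_trans (cP _) _.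
  by rewrite -mulrA ler_pM2l.
- move=> e e0; have ek : 0 < e / k by rewrite divr_gt0.
  have [r r0 rP] := diff_nr dF ek.
  exists (r / k); first by rewrite divr_gt0.
  move=> h; rewrite ltr_pdivlMr// mulrC => hr.
  rewrite /= iotaD -!pB; apply: le_trans (p_bound _) _.
  apply: le_trans (rP _ (le_lt_trans (iota_bound h) hr)) _.
  rewrite mulrAC ler_pdivrMr// -mulrA ler_pM2l// mulrC.
  exact: iota_bound.
split => // v.
by rewrite (deriveE v d1) d2 /= deriveE.
Qed.

(** Induction over all [F] at once: the derivative along [v] has the same shape with [F] replaced by
    ['D_(iota v) F], which is again complex differentiable everywhere. *)
Lemma Ck_real_comp j (F : U -> R[i]^o) : (forall x, differentiable F x) ->
  Ck j (fun v => p (F (iota v)) : R).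
Proof.
elim: j F => [|j IH] F dF /=.
  move=> x; apply: differentiable_continuous.
  by have [] := real_comp_differentiable (dF (iota x)).
split=> [x|v]; first by have [] := real_comp_differentiable (dF (iota x)).
rewrite (_ : 'D_v _ = fun x => p ('D_(iota v) F (iota x))).
  by apply: (IH ('D_(iota v) F)) => x; exact: differentiable_derive.
by apply/funext => x; have [_ ->] := real_comp_differentiable (dF (iota x)).
Qed.

End RealComposition.

Section Components.
Variable R : realType.

Lemma Re_lin (a : R) (z w : R[i]) :
  complex.Re (a%:C * z + w) = a * complex.Re z + complex.Re w.
Proof. by case: z w => [? ?] [? ?] /=; rewrite mul0r subr0. Qed.

Lemma Im_lin (a : R) (z w : R[i]) :
  complex.Im (a%:C * z + w) = a * complex.Im z + complex.Im w.
Proof. by case: z w => [? ?] [? ?] /=; rewrite mul0r addr0. Qed.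

Variables (V : normedModType R) (U : normedModType R[i]) (iota : V -> U) (k : R).
Hypothesis k0 : 0 < k.
Hypothesis iota_lin : forall a u v, iota (a *: u + v) = a%:C *: iota u + iota v.
Hypothesis iota_bound : forall v, nr (iota v) <= k * `|v|.

Lemma csmooth_comp (F : U -> R[i]^o) : (forall x, differentiable F x) ->
  csmooth (fun v => F (iota v)).
Proof.
move=> dF j; split.
  exact: (Ck_real_comp k0 iota_lin iota_bound (@Re_lin) (@Re_le_nr R)).
exact: (Ck_real_comp k0 iota_lin iota_bound (@Im_lin) (@Im_le_nr R)).
Qed.

End Components.

(** * Estimates for the entrywise maximum norm *)

Section MatrixNorm.

Lemma mx_entry_le (K : numFieldType) m n (A : 'M[K]_(m, n)) i j : `|A i j| <= `|A|.
Proof.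
rewrite [leRHS]/Num.norm /= mx_normE -[leLHS]nngE num_le.
exact: (le_bigmax _ (fun ij => `|A ij.1 ij.2|%:nng) (i, j)).
Qed.

Lemma mx_norm_le (K : numFieldType) m n (A : 'M[K]_(m, n)) (c : K) : 0 <= c ->
  (forall i j, `|A i j| <= c) -> `|A| <= c.
Proof.
move=> c0 Ac; rewrite [leLHS]/Num.norm /= mx_normE.
rewrite -[c]/((NngNum c0)%:num) num_le; apply/bigmax_leP; split=> [|ij _].
  by rewrite -num_le.
by rewrite -num_le /=.
Qed.

Lemma norm_mulmx_le (K : numFieldType) m n p (A : 'M[K]_(m, n)) (B : 'M[K]_(n, p)) :
  `|A *m B| <= n%:R * (`|A| * `|B|).
Proof.
apply: mx_norm_le => [|i j]; first by rewrite !mulr_ge0.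
rewrite mxE; apply: le_trans (ler_norm_sum _ _ _) _.
rewrite mulr_natl -[X in _ *+ X]card_ord -sumr_const; apply: ler_sum => k _.
by rewrite normrM ler_pM// mx_entry_le.
Qed.

Variable R : realType.

Lemma nr_mulmx_le m n p (A : 'M[R[i]]_(m, n)) (B : 'M[R[i]]_(n, p)) :
  nr (A *m B) <= n%:R * nr B * nr A.
Proof.
have := norm_mulmx_le A B; rewrite !nrE -!rmorphM -(rmorph_nat (real_complex R)).
by rewrite -rmorphM lecR mulrA mulrAC.
Qed.

Lemma nr_mx_le m n (A : 'M[R[i]]_(m, n)) (c : R) : 0 <= c ->
  (forall i j, nr (A i j : R[i]^o) <= c) -> nr A <= c.
Proof.
move=> c0 Ac; rewrite -lecR -nrE; apply: mx_norm_le => [|i j]; first by rewrite ler0c.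
by have := Ac i j; rewrite -lecR -nrE.
Qed.

Lemma nr_mx_entry m n (A : 'M[R[i]]_(m, n)) i j : nr (A i j : R[i]^o) <= nr A.
Proof. by rewrite -lecR -!nrE; exact: mx_entry_le. Qed.

Lemma nr_cmx m n (A : 'M[R]_(m, n)) : nr (cmx A) <= `|A|.
Proof.
by apply: nr_mx_le => // i j; rewrite mxE nr_real; exact: mx_entry_le.
Qed.

Lemma nr_pair (V W : normedModType R[i]) (x : V * W) :
  nr x = Num.max (nr x.1) (nr x.2).
Proof.
apply: complexI; rewrite -nrE prod_normE !nrE /Order.max ltcR.
by case: ifP.
Qed.

Lemma bounded_linear_differentiable (V W : normedModType R[i]) (T : V -> W) (k : R) :
  0 < k -> linear T -> (forall v, nr (T v) <= k * nr v) ->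
  forall x, differentiable T x.
Proof.
move=> k0 Tlin Tk x.
pose L : {linear V -> W} := HB.pack T (GRing.isLinear.Build _ _ _ _ _ Tlin).
have [||//] := @nr_diff _ _ _ T x L k k0 => // e e0; exists 1 => // h _.
have TD : T (x + h) = T x + T h by exact: (linearD L).
have -> : T (x + h) - T x - L h = 0 by rewrite TD [T x + _]addrC addrK subrr.
by rewrite nr0 mulr_ge0 ?nr_ge0// ltW.
Qed.

End MatrixNorm.

(** * The complexified Heisenberg group *)

Section DeriveLine.
Variables (K : numFieldType) (V W : normedModType K).

Lemma derive1_line (f : V -> W) (u : K -> W) x v :
  (forall t, u t = f (t *: v + x)) -> derive1 u 0 = 'D_v f x.
Proof.
move=> uf; rewrite /derive1 /derive.
have -> : (fun h => h^-1 *: (u (h + 0) - u 0)) =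
          (fun h => h^-1 *: ((f \o shift x) (h *: v) - f x)).
  by apply/funext => h; rewrite !uf addr0 scale0r add0r.
by [].
Qed.

Lemma eq_derive_line (f : V -> W) x v w :
  (forall t, f (t *: v + x) = f (t *: w + x)) -> 'D_v f x = 'D_w f x.
Proof.
by move=> vw; rewrite -(derive1_line (u := fun t => f (t *: v + x)))//; exact: derive1_line.
Qed.

End DeriveLine.

Section Complexification.
Variables (R : realType) (m n : nat) (S : 'M[int]_m) (Omega : 'M[R[i]]_n).
Let U : normedModType R[i] :=
  ('M[R[i]]_(m, n) * 'M[R[i]]_(m, n) * 'M[R[i]]_m)%type.
Implicit Types (f : 'M[R[i]]_(m, n) -> R[i]^o) (x : U) (g : heis R m n).

(** The [kappa] component goes to all complex matrices, not only symmetric ones, so that the target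
    is a product of plain matrix spaces. *)
Definition heis_complexify g : U := (cmx g.1.1, cmx g.1.2, cmx g.2).

Lemma cmx_linear m' n' (a : R) (A B : 'M[R]_(m', n')) :
  cmx (a *: A + B) = a%:C *: cmx A + cmx B.
Proof. by apply/matrixP => i j; rewrite !mxE rmorphD rmorphM. Qed.

Lemma heis_complexify_linear a (u v : heis R m n) :
  heis_complexify (a *: u + v) = a%:C *: heis_complexify u + heis_complexify v.
Proof.
by congr (_, _, _); rewrite -cmx_linear.
Qed.

Lemma heis_complexify_bound (v : heis R m n) : nr (heis_complexify v) <= 1 * `|v|.
Proof.
rewrite mul1r !nr_pair /= !ge_max !prod_normE /= !le_max !nr_cmx /=.
by rewrite !orbT.
Qed.

Definition theta_quad (L : 'M[R[i]]_(m, n)) (K : 'M[R[i]]_m) : R[i] :=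
  \tr (map_mx intr S *m (L *m Omega *m L^T + K)).

(** Its composition with [heis_complexify] is convertible to [phi_of], which transfers both
    smoothness and derivatives to the real group. *)
Definition phi_ext f x : R[i]^o :=
  cexp_pii (theta_quad x.1.1 x.2) * f (x.1.1 *m Omega + x.1.2).

Lemma nr_fst11 x : nr x.1.1 <= nr x.
Proof. by rewrite !nr_pair !le_max lexx. Qed.

Lemma nr_fst12 x : nr x.1.2 <= nr x.
Proof. by rewrite !nr_pair !le_max lexx orbT. Qed.

Lemma nr_snd2 x : nr x.2 <= nr x.
Proof. by rewrite [leRHS]nr_pair le_max lexx orbT. Qed.

Lemma differentiable_act x :
  differentiable (fun x : U => x.1.1 *m Omega + x.1.2) x.
Proof.
have k0 : 0 < n%:R * nr Omega + 1 by rewrite ltr_wpDl// mulr_ge0// nr_ge0.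
apply: (bounded_linear_differentiable k0) => [a u v|v].
  by rewrite /= mulmxDl -scalemxAl scalerDr addrACA.
apply: le_trans (nrD _ _) _; rewrite mulrDl mul1r lerD ?nr_fst12//.
apply: le_trans (nr_mulmx_le _ _) _.
by rewrite ler_wpM2l ?nr_fst11// mulr_ge0// nr_ge0.
Qed.

Lemma differentiable_entry11 (A : 'M[R[i]]_n) i k x :
  differentiable (fun x : U => (x.1.1 *m A) i k : R[i]^o) x.
Proof.
have k0 : 0 < n%:R * nr A + 1 by rewrite ltr_wpDl// mulr_ge0// nr_ge0.
apply: (bounded_linear_differentiable k0) => [a u v|v].
  by rewrite /= mulmxDl -scalemxAl !mxE.
apply: le_trans (nr_mx_entry _ _ _) _.
apply: le_trans (nr_mulmx_le _ _) _.
apply: ler_pM; rewrite ?mulr_ge0 ?nr_ge0 ?nr_fst11// ?lerDl//.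
Qed.

Lemma differentiable_entry2 i k x :
  differentiable (fun x : U => x.2 i k : R[i]^o) x.
Proof.
apply: (bounded_linear_differentiable ltr01) => [a u v|v].
  by rewrite /= !mxE.
by rewrite mul1r; apply: le_trans (nr_mx_entry _ _ _) _; exact: nr_snd2.
Qed.

Lemma differentiable_theta_quad x :
  differentiable (fun x : U => theta_quad x.1.1 x.2 : R[i]^o) x.
Proof.
(* The trace is expanded as a polynomial in matrix entries. The product with [1%:M] lets
   [differentiable_entry11] serve for both entry factors. *)
pose h (i j : 'I_m) : U -> R[i]^o := fun x =>
  (S i j)%:~R *: ((\sum_(k < n)
      (fun x : U => (x.1.1 *m Omega) j k * (x.1.1 *m 1%:M) i k : R[i]^o)) x
    + x.2 j i).
rewrite (_ : (fun _ => _) = \sum_(i < m) \sum_(j < m) h i j).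
  apply: differentiable_sum => i; apply: differentiable_sum => j.
  apply: differentiableZ; apply: differentiableD; last exact: differentiable_entry2.
  apply: differentiable_sum => k.
  by apply: differentiableM; exact: differentiable_entry11.
apply/funext => y; rewrite fct_sumE /theta_quad /mxtrace; apply: eq_bigr => i _.
rewrite fct_sumE mxE; apply: eq_bigr => j _; rewrite /h !mxE fct_sumE.
congr (_ * (_ + _)); apply: eq_bigr => k _; rewrite mulmx1.
by congr (_ * _); rewrite mxE.
Qed.

Lemma differentiable_phi_ext f : holomorphic f -> forall x, differentiable (phi_ext f) x.
Proof.
move=> df x; apply: differentiableM.
  have d1 : differentiable (fun x : U => (0 +i* pi) *: (theta_quad x.1.1 x.2 : R[i]^o) : R[i]^o) x.
    by apply: differentiableZ; exact: differentiable_theta_quad.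
  exact: (differentiable_comp d1 (differentiable_cexp _)).
exact: (differentiable_comp (differentiable_act x) (df _)).
Qed.

(* Along this direction the argument of [f] is constant and the exponent is even. *)
Lemma phi_ext_CR f x (E : 'M[R[i]]_(m, n)) : holomorphic f ->
  'D_(E, - (E *m Omega), - (x.1.1 *m Omega *m E^T + E *m Omega *m x.1.1^T)) (phi_ext f) x = 0.
Proof.
move=> df; have dF := differentiable_phi_ext df x.
set w := (E, _, _).
(* Evenness gives equal derivatives along [w] and [- w], while linearity makes them opposite; hence
   both vanish. In the exponent the terms linear in the parameter are cancelled by the third
   component of [w]. *)
have even (t : R[i]) : phi_ext f (t *: w + x) = phi_ext f (t *: (- w) + x).
  have H (s : R[i]) : phi_ext f (s *: w + x) =
    cexp_pii (theta_quad x.1.1 x.2 + s ^+ 2 * \tr (map_mx intr S *m (E *m Omega *m E^T))) *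
     f (x.1.1 *m Omega + x.1.2).
    rewrite /phi_ext /=; congr (cexp_pii _ * f _).
      rewrite /theta_quad -mxtraceZ scalemxAr -mxtraceD -mulmxDr; congr (\tr (_ *m _)).
      have -> : (s *: E + x.1.1)^T = s *: E^T + x.1.1^T by rewrite linearP.
      rewrite mulmxDl -scalemxAl mulmxDl !mulmxDr -!scalemxAl -!scalemxAr.
      move: (E *m Omega *m E^T) (E *m Omega *m x.1.1^T)
        (x.1.1 *m Omega *m E^T) (x.1.1 *m Omega *m x.1.1^T) (x.2) => P Q T Y K.
      by apply/matrixP => i j; rewrite !mxE; ring.
    by rewrite mulmxDl -scalemxAl scalerN addrACA subrr add0r.
  rewrite H scalerN -scaleNr H sqrrN; exact: erefl.
have : 'D_(- w) (phi_ext f) x = 'D_w (phi_ext f) x.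
  apply: eq_derive_line => t; exact: (esym (even t)).
have dN : 'd (phi_ext f) x (- w) = - 'd (phi_ext f) x w by exact: linearN.
rewrite (deriveE _ dF) (deriveE _ dF) dN => /eqP.
by rewrite eq_sym -addr_eq0 -mulr2n mulrn_eq0 /= => /eqP.
Qed.

End Complexification.

(** * Left-invariant derivatives *)

Section ComplexDirectional.
Variables (R : realType) (V : normedModType R).
Implicit Types (phi a b : V -> R[i]^o) (x v u : V).

Definition cdiff phi x : Prop :=
  differentiable (@complex.Re R \o phi : V -> R) x /\
  differentiable (@complex.Im R \o phi : V -> R) x.

(** [V] is normed over [R] and [R[i]^o] over [R[i]], so a real derivative of a complex-valued
    function is taken by components. *)
Definition cder v phi x : R[i] :=
  'D_v (@complex.Re R \o phi : V -> R) x +i* 'D_v (@complex.Im R \o phi : V -> R) x.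

Lemma csmooth_cdiff phi : csmooth phi -> forall x, cdiff phi x.
Proof. by move=> sphi x; have [[d1 _] [d2 _]] := sphi 1%N; split. Qed.

Lemma cder_linear phi x (t : R) u v : cdiff phi x ->
  cder (t *: u + v) phi x = t%:C * cder u phi x + cder v phi x.
Proof.
move=> [d1 d2].
have lin (q : V -> R) : differentiable q x -> 'D_(t *: u + v) q x = t * 'D_u q x + 'D_v q x.
  by move=> dq; rewrite !deriveE//; exact: linearP.
rewrite /cder (lin _ d1) (lin _ d2).
by apply/eqP; rewrite eq_complex /= !mul0r subr0 addr0 !eqxx.
Qed.

Lemma cder0 phi x : cder 0 phi x = 0.
Proof. by rewrite /cder !derive0. Qed.

Lemma ReM_fun a b : @complex.Re R \o (fun y => a y * b y) =
  (@complex.Re R \o a) * (@complex.Re R \o b) - (@complex.Im R \o a) * (@complex.Im R \o b)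
  :> (V -> R).
Proof. by apply/funext => y; rewrite /= !fctE /=; case: (a y) (b y) => [? ?] [? ?]. Qed.

Lemma ImM_fun a b : @complex.Im R \o (fun y => a y * b y) =
  (@complex.Re R \o a) * (@complex.Im R \o b) + (@complex.Im R \o a) * (@complex.Re R \o b)
  :> (V -> R).
Proof.
apply/funext => y; rewrite /= !fctE /=; case: (a y) (b y) => [? ?] [? ?] /=; ring.
Qed.

Lemma cdiffM a b x : cdiff a x -> cdiff b x -> cdiff (fun y => a y * b y) x.
Proof.
move=> [a1 a2] [b1 b2]; rewrite /cdiff ReM_fun ImM_fun; split.
  by apply: differentiableB; apply: differentiableM.
by apply: differentiableD; apply: differentiableM.
Qed.

Lemma cderM v a b x : cdiff a x -> cdiff b x ->
  cder v (fun y => a y * b y) x = cder v a x * b x + a x * cder v b x.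
Proof.
move=> [a1 a2] [b1 b2]; rewrite /cder ReM_fun ImM_fun.
have DM (p q r s : V -> R) : differentiable p x -> differentiable q x ->
    differentiable r x -> differentiable s x ->
    'D_v (p * q - r * s) x = p x * 'D_v q x + q x * 'D_v p x - (r x * 'D_v s x + s x * 'D_v r x) /\
    'D_v (p * q + r * s) x = p x * 'D_v q x + q x * 'D_v p x + (r x * 'D_v s x + s x * 'D_v r x).
  move=> /diff_derivable dp /diff_derivable dq /diff_derivable dr /diff_derivable ds.
  have m1 := derivableM (dp v) (dq v); have m2 := derivableM (dr v) (ds v).
  have e1 := deriveM (dp v) (dq v); have e2 := deriveM (dr v) (ds v).
  by split; [rewrite (deriveB m1 m2) e1 e2|rewrite (deriveD m1 m2) e1 e2].
rewrite (DM _ _ _ _ a1 b1 a2 b2).1 (DM _ _ _ _ a1 b2 a2 b1).2.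
move: ('D_v _ x) ('D_v _ x) ('D_v _ x) ('D_v _ x) => p q r s.
rewrite /=; case: (a x) (b x) => [c d] [c' d'] /=.
by apply/eqP; rewrite eq_complex /=; apply/andP; split; apply/eqP; ring.
Qed.

Variables (U : normedModType R[i]) (iota : V -> U) (k : R).
Hypothesis k0 : 0 < k.
Hypothesis iota_lin : forall (c : R) u v, iota (c *: u + v) = c%:C *: iota u + iota v.
Hypothesis iota_bound : forall v, nr (iota v) <= k * `|v|.

Lemma cder_comp (F : U -> R[i]^o) x v : differentiable F (iota x) ->
  cder v (fun y => F (iota y)) x = 'D_(iota v) F (iota x).
Proof.
move=> dF; rewrite /cder.
have [_ /(_ v) e1] := real_comp_differentiable k0 iota_lin iota_bound (@Re_lin R) (@Re_le_nr R) dF.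
have [_ /(_ v) e2] := real_comp_differentiable k0 iota_lin iota_bound (@Im_lin R) (@Im_le_nr R) dF.
rewrite [X in X +i* _]e1 [X in _ +i* X]e2.
by case: ('D_(iota v) F (iota x)).
Qed.

End ComplexDirectional.

Section HeisenbergDerivatives.
Variables (R : realType) (m n : nat).
Implicit Types (phi : heis R m n -> R[i]^o) (g : heis R m n).

Definition dirX (k : 'I_m) (a : 'I_n) : heis R m n := (delta_mx k a, 0, 0).

(** The value at [g] of the left-invariant field: its third component [lambda tE + E tlambda]
    depends on [g], and taking it from [heis_mul] supplies the proof of symmetry. *)
Definition dirXhat g (k : 'I_m) (a : 'I_n) : heis R m n :=
  (0, delta_mx k a, (heis_mul (g.1.1, 0, 0) (0, delta_mx k a, 0)).2).

Lemma heis_eq (g g' : heis R m n) : g.1.1 = g'.1.1 -> g.1.2 = g'.1.2 ->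
  (g.2 : 'M[R]_m) = g'.2 -> g = g'.
Proof.
case: g g' => [[l u] k] [[l' u'] k'] /= -> -> kk'; congr (_, _, _).
exact: val_inj.
Qed.

(** The group law is affine in its right factor, so right multiplication by the one-parameter
    subgroup moves [g] along a straight line. *)
Lemma lieD_X k a phi g : lieD (exp_X k a) phi g = cder (dirX k a) phi g.
Proof.
have E t : heis_mul g (exp_X k a t) = t *: dirX k a + g.
  apply: heis_eq; rewrite /= ?scaler0 ?add0r ?addr0//; first exact: addrC.
  by rewrite trmx0 mulmx0 mul0mx !addr0 ?scaler0 ?add0r.
by rewrite /lieD /cderive1 /cder; congr (_ +i* _); apply: derive1_line => t /=; rewrite E.
Qed.

Lemma lieD_Xhat k a phi g : lieD (exp_Xhat k a) phi g = cder (dirXhat g k a) phi g.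
Proof.
have E t : heis_mul g (exp_Xhat k a t) = t *: dirXhat g k a + g.
  apply: heis_eq; rewrite /= ?scaler0 ?add0r ?addr0//; first exact: addrC.
  rewrite linearZ /= -scalemxAl -scalemxAr scalerDr -addrA addrC.
  by [].
by rewrite /lieD /cderive1 /cder; congr (_ +i* _); apply: derive1_line => t /=; rewrite E.
Qed.

Variables (S : 'M[int]_m) (Omega : 'M[R[i]]_n).
Hypothesis OmegaT : Omega^T = Omega.
Variable f : 'M[R[i]]_(m, n) -> R[i]^o.
Hypothesis df : holomorphic f.

Lemma csmooth_phi_of : csmooth (phi_of S Omega f).
Proof.
exact: (csmooth_comp ltr01 (@heis_complexify_linear R m n)
  (@heis_complexify_bound R m n) (differentiable_phi_ext S Omega df)).
Qed.

(** The differential of [phi_ext] is complex linear, so the sum over [b] is its value on a single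
    vector, built from [E *m Omega]. Subtracting it from the direction [(E, 0, 0)] gives the
    direction of [phi_ext_CR]; symmetry of [Omega] identifies the third components. *)
Lemma phi_of_CR k a g : cder (dirX k a) (phi_of S Omega f) g =
  \sum_(b < n) Omega a b * cder (dirXhat g k b) (phi_of S Omega f) g.
Proof.
have dF := differentiable_phi_ext S Omega df.
have H v : cder v (phi_of S Omega f) g =
    'd (phi_ext S Omega f) (heis_complexify g) (heis_complexify v).
  rewrite -deriveE//.
  exact: (cder_comp ltr01 (@heis_complexify_linear R m n) (@heis_complexify_bound R m n)).
rewrite H; under eq_bigr do rewrite H.
set x := heis_complexify g; set L := 'd _ _.
have LP c u w : L (c *: u + w) = c *: L u + L w by exact: linearP.
pose T (Y : 'M[R[i]]_(m, n)) := x.1.1 *m Y^T + Y *m x.1.1^T.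
pose G (Y : 'M[R[i]]_(m, n)) : R[i]^o := L (0, Y, T Y).
have Glin : linear G.
  move=> c Y Z; rewrite /G -LP; congr (L _).
  rewrite /T; congr (_, _, _); rewrite /= ?scaler0 ?addr0//.
  rewrite linearP /= mulmxDr mulmxDl -scalemxAl -scalemxAr scalerDr.
  by rewrite addrACA.
pose Gl : {linear 'M[R[i]]_(m, n) -> R[i]^o} :=
  HB.pack G (GRing.isLinear.Build _ _ _ _ _ Glin).
pose E : 'M[R[i]]_(m, n) := delta_mx k a.
have cdelta b : cmx (delta_mx k b : 'M[R]_(m, n)) = delta_mx k b.
  by apply/matrixP => i j; rewrite !mxE; case: (_ && _).
have GE b : L (heis_complexify (dirXhat g k b)) = Gl (delta_mx k b).
  rewrite /= /G /heis_complexify /= cdelta; congr (L (_, _, _)).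
    by apply/matrixP => i j; rewrite !mxE.
  have cT (A : 'M[R]_(m, n)) : map_mx (real_complex R) A^T = (cmx A)^T.
    by apply/matrixP => i j; rewrite !mxE.
  have cd : map_mx (real_complex R) (delta_mx k b : 'M[R]_(m, n)) = delta_mx k b by exact: cdelta.
  rewrite /T /= !add0r [cmx _]map_mxD !map_mxM !cT cdelta cd; reflexivity.
under eq_bigr do rewrite GE.
have -> : \sum_(b < n) Omega a b * Gl (delta_mx k b) = Gl (E *m Omega).
  transitivity (\sum_(b < n) Gl (Omega a b *: delta_mx k b)).
    by apply: eq_bigr => b _; rewrite linearZ.
  rewrite -linear_sum; congr (Gl _); apply/matrixP => i j.
  rewrite summxE [RHS]mxE (bigD1 j)//= [RHS](bigD1 a)//= !big1 => [|c ca|b bj].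
  - by rewrite !mxE !eqxx !andbT !addr0 mulrC.
  - by rewrite !mxE (negbTE ca) andbF mul0r.
  - by rewrite !mxE [j == b]eq_sym (negbTE bj) andbF mulr0.
apply/eqP; rewrite -subr_eq0; apply/eqP.
have := phi_ext_CR S Omega x E df; rewrite deriveE//.
have LB u w : L (u - w) = L u - L w by exact: linearB.
move=> <-; rewrite /= /G -LB; congr (L _); congr (_, _, _) => /=.
- by rewrite subr0 cdelta.
- by apply/matrixP => i j; rewrite !mxE sub0r.
- rewrite /T trmx_mul OmegaT mulmxA.
  by apply/matrixP => i j; rewrite !mxE sub0r.
Qed.

End HeisenbergDerivatives.

(** * Transformation laws and the section of the action *)

Section Automorphy.
Variables (R : realType) (m n : nat) (S : 'M[int]_m) (Omega : 'M[R[i]]_n).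
Hypothesis ST : S^T = S.
Hypothesis OmegaT : Omega^T = Omega.
Implicit Types (g : heis R m n).

Lemma cexp_piiD (z w : R[i]) : cexp_pii (z + w) = cexp_pii z * cexp_pii w.
Proof. by rewrite /cexp_pii mulrDr cexpD. Qed.

Lemma cexp_piiN (z : R[i]) : cexp_pii (- z) = (cexp_pii z)^-1.
Proof. by rewrite /cexp_pii mulrN cexpN. Qed.

Lemma cexp_pii_neq0 (z : R[i]) : cexp_pii z != 0.
Proof. exact: cexp_neq0. Qed.

Lemma Jtilde0_neq0 g : Jtilde0 S Omega g != 0.
Proof. exact: cexp_pii_neq0. Qed.

Lemma Jtilde0E g : Jtilde0 S Omega g = cexp_pii (theta_quad S Omega (cmx g.1.1) (cmx g.2)).
Proof. by []. Qed.

(** With [Z = X t(L Omega + Y)], the cross terms add up to [Z + Z^T] because [Omega] is symmetric,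
    and symmetry of [S] gives both the same trace against [S]. *)
Lemma theta_quad_shift (X Y L : 'M[R[i]]_(m, n)) (K : 'M[R[i]]_m) :
  theta_quad S Omega (X + L) (K + X *m Y^T + Y *m X^T) =
  \tr (map_mx intr S *m (X *m Omega *m X^T + 2 *: (X *m (L *m Omega + Y)^T))) +
  theta_quad S Omega L K.
Proof.
set T := map_mx intr S; set Z := X *m (L *m Omega + Y)^T.
have TZ : \tr (T *m Z^T) = \tr (T *m Z).
  rewrite -mxtrace_tr trmx_mul trmxK mxtrace_mulC; congr (\tr (_ *m _)).
  by rewrite /T map_trmx ST.
have E : (X + L) *m Omega *m (X + L)^T + (K + X *m Y^T + Y *m X^T) =
    X *m Omega *m X^T + (Z + Z^T) + (L *m Omega *m L^T + K).
  rewrite /Z trmx_mul trmxK [(L *m _ + _)^T]linearD /= trmx_mul OmegaT.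
  rewrite [(X + L)^T]linearD /= !mulmxDl !mulmxDr !mulmxA.
  move: (X *m Omega *m X^T) (X *m Omega *m L^T) (L *m Omega *m X^T)
    (L *m Omega *m L^T) (X *m Y^T) (Y *m X^T) => a b c d e h.
  by apply/matrixP => i j; rewrite !mxE; ring.
rewrite /theta_quad -/T E !mulmxDr !mxtraceD TZ -scalemxAr mxtraceZ.
move: (\tr _) (\tr _) (\tr _) (\tr _) => a b c d; ring.
Qed.

Lemma cmx_intr m' n' (xi : 'M[int]_(m', n')) :
  cmx (map_mx intr xi : 'M[R]_(m', n')) = map_mx intr xi.
Proof. by apply/matrixP => i j; rewrite !mxE rmorph_int. Qed.

Lemma cmxD m' n' (A B : 'M[R]_(m', n')) : cmx (A + B) = cmx A + cmx B.
Proof. by apply/matrixP => i j; rewrite !mxE rmorphD. Qed.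

Lemma act0_shift (xi eta : 'M[int]_(m, n)) g :
  act0 Omega (heis_mul (map_mx intr xi, map_mx intr eta, 0) g) =
  act0 Omega g + map_mx intr xi *m Omega + map_mx intr eta.
Proof.
rewrite /act0 /= !cmxD !cmx_intr mulmxDl.
move: (cmx g.1.1 *m _) (cmx g.1.2) => a b.
by apply/matrixP => i j; rewrite !mxE; ring.
Qed.

(** The factor is the inverse of the quasi-periodicity factor at [act0 Omega g], so the two cancel
    in [phi_of]. *)
Lemma Jtilde0_shift (xi eta : 'M[int]_(m, n)) g :
  Jtilde0 S Omega (heis_mul (map_mx intr xi, map_mx intr eta, 0) g) =
  cexp_pii (\tr (map_mx intr S *m (map_mx intr xi *m Omega *m (map_mx intr xi)^T +
     2 *: (map_mx intr xi *m (act0 Omega g)^T)))) * Jtilde0 S Omega g.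
Proof.
rewrite !Jtilde0E -cexp_piiD -theta_quad_shift; congr cexp_pii.
have cT (A : 'M[R]_(m, n)) : cmx A^T = (cmx A)^T.
  by apply/matrixP => i j; rewrite !mxE.
have cM (A B : 'M[R]_(m, n)) : cmx (A *m B^T) = cmx A *m (cmx B)^T.
  by rewrite -cT; exact: map_mxM.
by rewrite /= add0r !cmxD !cM !cmx_intr.
Qed.

Lemma act0_center (kappa : symmx R m) g :
  act0 Omega (heis_mul g (0, 0, kappa)) = act0 Omega g.
Proof. by rewrite /act0 /= !addr0. Qed.

Lemma Jtilde0_center (kappa : symmx R m) g :
  Jtilde0 S Omega (heis_mul g (0, 0, kappa)) =
  cexp_pii (\tr (map_mx intr S *m cmx kappa)) * Jtilde0 S Omega g.
Proof.
rewrite !Jtilde0E -cexp_piiD; congr cexp_pii.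
rewrite /theta_quad /= !addr0 trmx0 mulmx0 mul0mx !addr0 cmxD addrA mulmxDr mxtraceD.
exact: addrC.
Qed.

Lemma phi_of_aut_space (f : 'M[R[i]]_(m, n) -> R[i]^o) :
  theta_space S Omega f -> aut_space S Omega (phi_of S Omega f).
Proof.
move=> [df fth]; split; first exact: csmooth_phi_of.
split=> [xi eta g|kappa g|k a g].
- rewrite /phi_of act0_shift fth Jtilde0_shift cexp_piiN mulrACA.
  by rewrite [X in X * _]mulrC mulrA mulVf ?mul1r// cexp_pii_neq0.
- by rewrite /phi_of act0_center Jtilde0_center mulrA.
- rewrite lieD_X; under eq_bigr do rewrite lieD_Xhat.
  by rewrite phi_of_CR// subrr.
Qed.

End Automorphy.

Section ActionSection.
Variables (R : realType) (m n : nat) (Omega : 'M[R[i]]_n).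
Hypothesis ImOmega : posdefmx (map_mx (@complex.Im R) Omega).
Implicit Types (g : heis R m n) (W : 'M[R[i]]_(m, n)).

Lemma posdef_unitmx (A : 'M[R]_n) : posdefmx A -> A \in unitmx.
Proof.
move=> pA; rewrite -row_free_unit; apply: inj_row_free => v vA.
apply: contrapT => /eqP v0.
have : v^T != 0 by apply: contra v0 => /eqP/(congr1 trmx); rewrite trmxK trmx0 => ->.
by move=> /pA; rewrite trmxK vA mul0mx mxE ltxx.
Qed.

Lemma Re_act0 g : map_mx (@complex.Re R) (act0 Omega g) =
  g.1.1 *m map_mx (@complex.Re R) Omega + g.1.2.
Proof.
apply/matrixP => i j; rewrite !mxE.
have -> : complex.Re (\sum_k cmx g.1.1 i k * Omega k j + (g.1.2 i j)%:C) =
   complex.Re (\sum_k cmx g.1.1 i k * Omega k j) + g.1.2 i j by case: (\sum_k _).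
congr (_ + _).
rewrite (big_morph (@complex.Re R) (id1 := 0) (op1 := +%R)) //; last by move=> [? ?] [? ?].
by apply: eq_bigr => k _; rewrite !mxE; case: (Omega k j) => ? ? /=; rewrite mul0r subr0.
Qed.

Lemma Im_act0 g : map_mx (@complex.Im R) (act0 Omega g) =
  g.1.1 *m map_mx (@complex.Im R) Omega.
Proof.
apply/matrixP => i j; rewrite !mxE.
have -> : complex.Im (\sum_k cmx g.1.1 i k * Omega k j + (g.1.2 i j)%:C) =
   complex.Im (\sum_k cmx g.1.1 i k * Omega k j).
  by case: (\sum_k _) => ? ? /=; rewrite addr0.
rewrite (big_morph (@complex.Im R) (id1 := 0) (op1 := +%R)) //; last by move=> [? ?] [? ?].
by apply: eq_bigr => k _; rewrite !mxE; case: (Omega k j) => ? ? /=; rewrite mul0r addr0.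
Qed.

(** The solution of [Im W = lambda Im Omega]. It leads to a section of [act0] that is linear over
    [R], though in general not a complex-linear object. *)
Definition lambda_of W : 'M[R]_(m, n) :=
  map_mx (@complex.Im R) W *m invmx (map_mx (@complex.Im R) Omega).

Definition heis_of W : heis R m n :=
  (lambda_of W, map_mx (@complex.Re R) W - lambda_of W *m map_mx (@complex.Re R) Omega, 0).

Lemma complex_mx_eq m' n' (A B : 'M[R[i]]_(m', n')) :
  map_mx (@complex.Re R) A = map_mx (@complex.Re R) B ->
  map_mx (@complex.Im R) A = map_mx (@complex.Im R) B -> A = B.
Proof.
move=> /matrixP re /matrixP im; apply/matrixP => i j.
apply/eqP; rewrite eq_complex.
by have := re i j; have := im i j; rewrite !mxE => -> ->; rewrite !eqxx.
Qed.

Lemma heis_ofK W : act0 Omega (heis_of W) = W.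
Proof.
apply: complex_mx_eq; rewrite ?Re_act0 ?Im_act0 /=.
  by rewrite addrC subrK.
by rewrite mulmxKV// posdef_unitmx.
Qed.

Lemma act0_inj g g' : act0 Omega g = act0 Omega g' -> g.1 = g'.1.
Proof.
move=> gg'.
have e1 : g.1.1 = g'.1.1.
  have := congr1 (map_mx (@complex.Im R)) gg'; rewrite !Im_act0.
  move=> /(congr1 (mulmx^~ (invmx (map_mx (@complex.Im R) Omega)))).
  by rewrite !mulmxK// posdef_unitmx.
have e2 : g.1.2 = g'.1.2.
  have := congr1 (map_mx (@complex.Re R)) gg'; rewrite !Re_act0 e1.
  exact: addrI.
by rewrite [LHS]surjective_pairing e1 e2 -surjective_pairing.
Qed.

Lemma lambda_of_linear (t : R) W W' :
  lambda_of (t%:C *: W + W') = t *: lambda_of W + lambda_of W'.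
Proof.
rewrite /lambda_of scalemxAl -mulmxDl; congr (_ *m _).
by apply/matrixP => i j; rewrite !mxE Im_lin.
Qed.

Lemma heis_of_linear (t : R) W W' :
  heis_of (t%:C *: W + W') = t *: heis_of W + heis_of W'.
Proof.
apply: heis_eq; rewrite /= ?lambda_of_linear//.
  rewrite mulmxDl -scalemxAl.
  move: (lambda_of W *m _) (lambda_of W' *m _) => a b.
  by apply/matrixP => i j; rewrite !mxE Re_lin; ring.
by rewrite scaler0 addr0.
Qed.

Lemma heis_of_bound : exists2 k : R, 0 < k & forall W, `|heis_of W| <= k * nr W.
Proof.
have im W : `|map_mx (@complex.Im R) W| <= nr W.
  apply: mx_norm_le => [|i j]; rewrite ?nr_ge0// mxE.
  by apply: le_trans (Im_le_nr (W i j : R[i]^o)) _; exact: nr_mx_entry.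
have re W : `|map_mx (@complex.Re R) W| <= nr W.
  apply: mx_norm_le => [|i j]; rewrite ?nr_ge0// mxE.
  by apply: le_trans (Re_le_nr (W i j : R[i]^o)) _; exact: nr_mx_entry.
pose a : R := n%:R * `|invmx (map_mx (@complex.Im R) Omega)|.
pose b : R := n%:R * `|map_mx (@complex.Re R) Omega|.
have a0 : 0 <= a by rewrite mulr_ge0.
have b0 : 0 <= b by rewrite mulr_ge0.
have la W : `|lambda_of W| <= a * nr W.
  apply: le_trans (norm_mulmx_le _ _) _; rewrite mulrCA mulrC -/a.
  by rewrite ler_wpM2l.
(* The [lambda] component is bounded with [a] and the [mu] component with [1 + a * b]. *)
exists (1 + a + a * b); first by rewrite ltr_pwDl ?mulr_ge0// ltr_pwDl.
move=> W; rewrite !prod_normE /= !ge_max normr0.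
have := nr_ge0 W => W0; have aW := mulr_ge0 a0 W0; have abW := mulr_ge0 (mulr_ge0 a0 b0) W0.
apply/andP; split; last by rewrite mulr_ge0// addr_ge0 ?mulr_ge0// addr_ge0.
apply/andP; split; first by apply: le_trans (la W) _; rewrite !mulrDl; lra.
apply: le_trans (ler_normB _ _) _.
have : `|lambda_of W *m map_mx (@complex.Re R) Omega| <= a * b * nr W.
  apply: le_trans (norm_mulmx_le _ _) _; rewrite mulrCA -/b.
  apply: le_trans (ler_wpM2r b0 (la W)) _.
  by rewrite mulrAC.
by have := re W; rewrite !mulrDl; lra.
Qed.

End ActionSection.

(** * From automorphic functions to theta functions *)

Section Converse.
Variables (R : realType) (m n : nat) (S : 'M[int]_m) (Omega : 'M[R[i]]_n).
Hypothesis ST : S^T = S.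
Hypothesis OmegaT : Omega^T = Omega.
Hypothesis ImOmega : posdefmx (map_mx (@complex.Im R) Omega).

Lemma cder_expand (V : normedModType R) (phi : V -> R[i]^o) x : cdiff phi x ->
  forall e, 0 < e -> exists2 r, 0 < r & forall h, `|h| < r ->
    nr (phi (x + h) - phi x - cder h phi x : R[i]^o) <= e * `|h|.
Proof.
move=> [d1 d2] e e0; have e2 : 0 < e / 2 by rewrite divr_gt0.
have [r1 r10 r1P] := diff_expand d1 e2; have [r2 r20 r2P] := diff_expand d2 e2.
exists (Num.min r1 r2); first by rewrite lt_min r10.
move=> h; rewrite lt_min => /andP[/r1P h1 /r2P h2].
move: h1 h2; rewrite -!deriveE// => h1 h2.
apply: le_trans (nr_le _) _; rewrite (_ : e * `|h| = e / 2 * `|h| + e / 2 * `|h|); last by field.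
apply: lerD; [apply: le_trans h1|apply: le_trans h2]; rewrite /cder /=;
  by move: ('D_h _ x) ('D_h _ x) => p q; case: (phi (x + h)) (phi x) => [? ?] [? ?].
Qed.

Variable phi : heis R m n -> R[i]^o.
Hypothesis phi_aut : aut_space S Omega phi.

(** The inverse of [J~] is the lift of the constant [1] for the matrix [- S]. Its smoothness and the
    equations (c) are therefore instances of results already proved for [phi_of]. *)
Let Jinv : heis R m n -> R[i]^o := phi_of (- S) Omega (cst 1).

Let JinvE g : Jinv g = (Jtilde0 S Omega g)^-1.
Proof.
have SN : map_mx intr (- S) = - map_mx intr S :> 'M[R[i]]_m.
  by apply/matrixP => i j; rewrite !mxE rmorphN.
by rewrite /Jinv /phi_of /Jtilde0 mulr1 SN mulNmx linearN cexp_piiN.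
Qed.

Let psi (g : heis R m n) : R[i]^o := Jinv g * phi g.

(** Two points with the same image differ by a central element, and by (b) the factors that [phi]
    and [J~] acquire there are equal. *)
Let psi_act g g' : act0 Omega g = act0 Omega g' -> psi g = psi g'.
Proof.
move=> /(act0_inj ImOmega) gg'.
have [_ [_ phib _]] := phi_aut.
have -> : g' = heis_mul g (0, 0, g'.2 - g.2).
  apply: heis_eq; rewrite /= ?addr0 ?gg'//.
  by rewrite trmx0 mulmx0 mul0mx !addr0 addrC subrK.
have cancel (c j p : R[i]) : c != 0 -> j^-1 * p = (c * j)^-1 * (c * p).
  by move=> c0; rewrite invfM mulrACA (mulVf c0) mul1r.
rewrite /psi !JinvE phib Jtilde0_center; exact: cancel (cexp_pii_neq0 _).
Qed.

Lemma f_of_unique W g : act0 Omega g = W ->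
  f_of S Omega phi W = (Jtilde0 S Omega g)^-1 * phi g.
Proof.
move=> gW; have gP : act0 Omega (get [set g | act0 Omega g = W]) = act0 Omega g.
  rewrite gW; exact: (@getPex _ [set g | act0 Omega g = W] (ex_intro _ g gW)).
have := psi_act gP; rewrite /psi !JinvE; exact.
Qed.

Let holo1 : holomorphic (cst 1 : 'M[R[i]]_(m, n) -> R[i]^o).
Proof. by move=> W; exact: differentiable_cst. Qed.

Let Jinv_cdiff g : cdiff Jinv g.
Proof. exact: csmooth_cdiff (csmooth_phi_of _ _ holo1) g. Qed.

Let phi_cdiff g : cdiff phi g.
Proof. by apply: csmooth_cdiff; case: phi_aut. Qed.

Let psi_cdiff g : cdiff psi g.
Proof. exact: cdiffM. Qed.

(** The operator in (c) is a derivation that annihilates both factors of [psi]. *)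
Let psi_CR (k : 'I_m) (a : 'I_n) (g : heis R m n) : cder (dirX R k a) psi g =
  \sum_(b < n) Omega a b * cder (dirXhat g k b) psi g.
Proof.
have [_ [_ _ phic]] := phi_aut.
have phiX : cder (dirX R k a) phi g = \sum_(b < n) Omega a b * cder (dirXhat g k b) phi g.
  have /eqP := phic k a g; rewrite subr_eq0 lieD_X => /eqP ->.
  by apply: eq_bigr => b _; rewrite lieD_Xhat.
rewrite (cderM _ (Jinv_cdiff g) (phi_cdiff g)) phiX (phi_of_CR (- S) OmegaT holo1).
rewrite mulr_suml mulr_sumr -big_split /=; apply: eq_bigr => b _.
by rewrite (cderM _ (Jinv_cdiff g) (phi_cdiff g)); ring.
Qed.

Let psi_center (kappa : symmx R m) (g : heis R m n) : cder (0, 0, kappa) psi g = 0.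
Proof.
have E0 (t : R) : psi (t *: ((0, 0, kappa) : heis R m n) + g) = psi (t *: (0 : heis R m n) + g).
  by apply: psi_act; rewrite /act0 /= !scaler0.
have E (p : R[i] -> R) : 'D_((0, 0, kappa) : heis R m n) (p \o psi : heis R m n -> R) g = 0.
  rewrite -(derive0 (p \o psi : heis R m n -> R) g); apply: eq_derive_line => t.
  exact: (congr1 p (E0 t)).
rewrite /cder !E; exact: erefl.
Qed.

Lemma matrix_linear_sum (T : 'M[R]_(m, n) -> R[i]) :
  (forall (t : R) A B, T (t *: A + B) = t%:C * T A + T B) -> T 0 = 0 ->
  forall A, T A = \sum_i \sum_j (A i j)%:C * T (delta_mx i j).
Proof.
move=> Tlin T0 A; rewrite {1}[A]matrix_sum_delta.
have TD B C : T (B + C) = T B + T C by rewrite -[B]scale1r Tlin mul1r scale1r.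
rewrite (big_morph T TD T0); apply: eq_bigr => i _.
rewrite (big_morph T TD T0); apply: eq_bigr => j _.
by rewrite -[_ *: _]addr0 Tlin T0 addr0.
Qed.

(** Write the direction as [(L, 0, 0) + (0, M, 0)]. The equations (c) turn the first part into
    derivatives in [mu] with coefficients [L Omega], and adding those of the second gives
    [L Omega + M = h]. *)
Let cder_psi_heis_of (g : heis R m n) (h : 'M[R[i]]_(m, n)) : cder (heis_of Omega h) psi g =
  \sum_i \sum_j h i j * cder ((0, delta_mx i j, 0) : heis R m n) psi g.
Proof.
set l := fun i j => cder ((0, delta_mx i j, 0) : heis R m n) psi g.
set L := lambda_of Omega h; set M := (heis_of Omega h).1.2.
have hE i j : h i j = \sum_k (L i k)%:C * Omega k j + (M i j)%:C.
  rewrite -[in LHS](heis_ofK ImOmega h) !mxE; congr (_ + _).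
  by apply: eq_bigr => k _; rewrite !mxE.
(* The third component of the invariant direction is central, where [psi] is constant. *)
have hat i j : cder (dirXhat g i j) psi g = l i j.
  have -> : dirXhat g i j = 1 *: ((0, delta_mx i j, 0) : heis R m n) + (0, 0, (dirXhat g i j).2).
    by rewrite scale1r -[RHS]/(0 + 0, delta_mx i j + 0, 0 + (dirXhat g i j).2) !addr0 add0r.
  by rewrite cder_linear// psi_center mul1r addr0.
have -> : heis_of Omega h = 1 *: ((L, 0, 0) : heis R m n) + (0, M, 0).
  by rewrite scale1r -[RHS]/(L + 0, 0 + M, 0 + 0) !addr0 add0r.
rewrite cder_linear// mul1r.
have c0 : cder ((0, 0, 0) : heis R m n) psi g = 0 := cder0 psi g.
have lin1 (t : R) (A B : 'M[R]_(m, n)) : cder ((t *: A + B, 0, 0) : heis R m n) psi g =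
    t%:C * cder ((A, 0, 0) : heis R m n) psi g + cder ((B, 0, 0) : heis R m n) psi g.
  have -> : (t *: A + B, 0, 0) = t *: ((A, 0, 0) : heis R m n) + (B, 0, 0).
    by rewrite -[RHS]/(t *: A + B, t *: 0 + 0, t *: 0 + 0) !scaler0 !addr0.
  exact: cder_linear.
have lin2 (t : R) (A B : 'M[R]_(m, n)) : cder ((0, t *: A + B, 0) : heis R m n) psi g =
    t%:C * cder ((0, A, 0) : heis R m n) psi g + cder ((0, B, 0) : heis R m n) psi g.
  have -> : (0, t *: A + B, 0) = t *: ((0, A, 0) : heis R m n) + (0, B, 0).
    by rewrite -[RHS]/(t *: 0 + 0, t *: A + B, t *: 0 + 0) !scaler0 !addr0.
  exact: cder_linear.
have e2 : cder ((0, M, 0) : heis R m n) psi g = \sum_i \sum_j (M i j)%:C * l i j.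
  exact: (matrix_linear_sum lin2 c0 M).
have e1 : cder ((L, 0, 0) : heis R m n) psi g =
    \sum_i \sum_j (\sum_k (L i k)%:C * Omega k j) * l i j.
  apply: etrans (matrix_linear_sum lin1 c0 L) _; apply: eq_bigr => i _.
  transitivity (\sum_j \sum_k (L i j)%:C * Omega j k * l i k).
    apply: eq_bigr => j _.
    have -> : cder ((delta_mx i j, 0, 0) : heis R m n) psi g = \sum_k Omega j k * l i k.
      by apply: etrans (psi_CR i j g) _; apply: eq_bigr => k _; rewrite hat.
    by rewrite mulr_sumr; apply: eq_bigr => k _; rewrite mulrA.
  by rewrite exchange_big /=; apply: eq_bigr => j _; rewrite mulr_suml.
rewrite e1 e2 -big_split; apply: eq_bigr => i _ /=; rewrite -big_split.
by apply: eq_bigr => j _ /=; rewrite hE mulrDl.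
Qed.

Let f_ofE W : f_of S Omega phi W = psi (heis_of Omega W).
Proof. by rewrite (f_of_unique (heis_ofK ImOmega W)) -JinvE. Qed.

(** The real expansion of [psi], pulled back along the bounded section, has a complex-linear leading
    term and is therefore a complex expansion. *)
Lemma f_of_holomorphic : holomorphic (f_of S Omega phi).
Proof.
move=> W; set g := heis_of Omega W.
pose l i j := cder ((0, delta_mx i j, 0) : heis R m n) psi g.
pose T (h : 'M[R[i]]_(m, n)) : R[i]^o := \sum_i \sum_j h i j * l i j.
have Tlin : linear T.
  move=> c u v; rewrite /T scaler_sumr -big_split; apply: eq_bigr => i _ /=.
  rewrite scaler_sumr -big_split; apply: eq_bigr => j _ /=.
  by rewrite !mxE mulrDl -mulrA.
pose L : {linear 'M[R[i]]_(m, n) -> R[i]^o} :=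
  HB.pack T (GRing.isLinear.Build _ _ _ _ _ Tlin).
pose K : R := \sum_i \sum_j nr (l i j : R[i]^o).
have nr_sum (I : finType) (F : I -> R[i]^o) : nr (\sum_i F i) <= \sum_i nr (F i).
  elim/big_ind2 : _ => [|x1 x2 y1 y2 h1 h2|//]; first by rewrite nr0.
  by apply: le_trans (nrD _ _) _; exact: lerD.
have K0 : 0 <= K by rewrite !sumr_ge0// => i _; rewrite sumr_ge0// => j _; exact: nr_ge0.
have K1 : 0 < K + 1 by rewrite ltr_wpDl.
have [k k0 kP] := @heis_of_bound R m n Omega.
have heisD h : heis_of Omega (W + h) = g + heis_of Omega h.
  by rewrite -[W]scale1r heis_of_linear !scale1r.
have [||//] := @nr_diff _ _ _ (f_of S Omega phi) W L (K + 1) K1.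
- move=> h; apply: (@le_trans _ _ (K * nr h)); last by rewrite ler_wpM2r ?nr_ge0// lerDl.
  rewrite /= /T /K; apply: le_trans (nr_sum _ _) _; rewrite mulr_suml.
  apply: ler_sum => i _; apply: le_trans (nr_sum _ _) _; rewrite mulr_suml.
  apply: ler_sum => j _; rewrite nrM mulrC ler_wpM2l ?nr_ge0//.
  exact: nr_mx_entry.
- move=> e e0; have ek : 0 < e / k by rewrite divr_gt0.
  have [r r0 rP] := cder_expand (psi_cdiff g) ek.
  exists (r / k); first by rewrite divr_gt0.
  move=> h; rewrite ltr_pdivlMr// mulrC => hr.
  rewrite !f_ofE heisD -/g /= /T -cder_psi_heis_of.
  apply: le_trans (rP _ (le_lt_trans (kP h) hr)) _.
  by rewrite mulrAC ler_pdivrMr// -mulrA ler_wpM2l ?(ltW e0)// mulrC.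
Qed.

Lemma f_of_theta_space : theta_space S Omega (f_of S Omega phi).
Proof.
split; first exact: f_of_holomorphic.
move=> W xi eta /=; have [_ [phia _ _]] := phi_aut.
have W0 := heis_ofK ImOmega W.
have Wx := act0_shift Omega xi eta (heis_of Omega W).
(* Independence of the representative allows evaluation at the translated group element, where (a)
   leaves [phi] unchanged and only [J~] contributes a factor. *)
rewrite W0 in Wx; rewrite (f_of_unique Wx) (f_of_unique W0) phia Jtilde0_shift//.
by rewrite W0 invfM mulrA cexp_piiN.
Qed.

Lemma f_ofK : phi_of S Omega (f_of S Omega phi) = phi.
Proof.
apply/funext => g; rewrite /phi_of (f_of_unique (erefl (act0 Omega g))).
by rewrite mulrA mulfV ?mul1r// Jtilde0_neq0.
Qed.

End Converse.

(** * Linearity and the two inverse maps *)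

Section Isomorphism.
Variables (R : realType) (m n : nat) (S : 'M[int]_m) (Omega : 'M[R[i]]_n).

Lemma phi_of_linear (c : R[i]) (f1 f2 : 'M[R[i]]_(m, n) -> R[i]^o) :
  phi_of S Omega (c *: f1 + f2) = c *: phi_of S Omega f1 + phi_of S Omega f2.
Proof.
apply/funext => g; rewrite /phi_of -[LHS]/(_ * (c * f1 _ + f2 _)).
by rewrite -[RHS]/(c * (_ * f1 _) + _ * f2 _); ring.
Qed.

Lemma theta_space_linear (c : R[i]) (f1 f2 : 'M[R[i]]_(m, n) -> R[i]^o) :
  theta_space S Omega f1 -> theta_space S Omega f2 -> theta_space S Omega (c *: f1 + f2).
Proof.
move=> [h1 t1] [h2 t2]; split.
  by move=> W; apply: differentiableD; [apply: differentiableZ; exact: h1|exact: h2].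
move=> W xi eta /=; rewrite -[LHS]/(c * f1 _ + f2 _) t1 t2.
by rewrite -[RHS]/(_ * (c * f1 _ + f2 _)); ring.
Qed.

Lemma theta_space0 : theta_space S Omega (0 : 'M[R[i]]_(m, n) -> R[i]^o).
Proof.
split=> [W|W xi eta /=]; first exact: differentiable_cst.
by rewrite -[RHS]/(_ * 0) mulr0.
Qed.

Hypothesis ImOmega : posdefmx (map_mx (@complex.Im R) Omega).

Lemma phi_ofK (f : 'M[R[i]]_(m, n) -> R[i]^o) : f_of S Omega (phi_of S Omega f) = f.
Proof.
apply/funext => W; rewrite /f_of /phi_of.
(* A preimage exists, so [get] returns one and not its default value. *)
have -> : act0 Omega (get [set g | act0 Omega g = W]) = W.
  exact: (@getPex _ [set g | act0 Omega g = W] (ex_intro _ _ (heis_ofK ImOmega W))).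
by rewrite mulrA mulVf ?mul1r// Jtilde0_neq0.
Qed.

End Isomorphism.

Theorem theorem3p14 (R : realType) (m n : nat) (S : 'M[int]_m)
    (Omega : 'M[R[i]]_n)
    (hm : (0 < m)%N) (hn : (0 < n)%N)
    (hSsym : S^T = S) (hSpos : posdefmx (map_mx intr S : 'M[R]_m))
    (hOmega : siegel Omega) :
  (submod_closed [pred f | f \in theta_space S Omega] /\
   submod_closed [pred phi | phi \in aut_space S Omega])
  /\ (forall (c : R[i]) (f1 f2 : 'M[R[i]]_(m, n) -> R[i]^o),
        theta_space S Omega f1 -> theta_space S Omega f2 ->
        phi_of S Omega (c *: f1 + f2) =
        c *: phi_of S Omega f1 + phi_of S Omega f2)
  /\ set_bij (theta_space S Omega) (aut_space S Omega) (phi_of S Omega)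
  /\ (forall W : 'M[R[i]]_(m, n), exists g0 : heis R m n, act0 Omega g0 = W)
  /\ (forall phi : heis R m n -> R[i]^o, aut_space S Omega phi ->
        forall (W : 'M[R[i]]_(m, n)) (g0 : heis R m n), act0 Omega g0 = W ->
        f_of S Omega phi W = (Jtilde0 S Omega g0)^-1 * phi g0)
  /\ (forall phi : heis R m n -> R[i]^o, aut_space S Omega phi ->
        theta_space S Omega (f_of S Omega phi) /\
        phi_of S Omega (f_of S Omega phi) = phi)
  /\ (forall f : 'M[R[i]]_(m, n) -> R[i]^o, theta_space S Omega f ->
        f_of S Omega (phi_of S Omega f) = f).
Proof.
have [OmegaT ImOmega] := hOmega.
have inA f := phi_of_aut_space hSsym OmegaT (f := f).
have inT phi (hphi : aut_space S Omega phi) := f_of_theta_space hSsym OmegaT ImOmega hphi.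
have fK phi (hphi : aut_space S Omega phi) := f_ofK ImOmega hphi.
split; [split; split|split; [|split; [split|split; [|split; [|split]]]]].
- exact: mem_set (theta_space0 S Omega).
- move=> c f1 f2 /set_mem h1 /set_mem h2; apply: mem_set.
  exact: theta_space_linear.
- apply: mem_set.
  have -> : (0 : heis R m n -> R[i]^o) = phi_of S Omega 0.
    by apply/funext => g; rewrite /phi_of -[RHS]/(_ * 0) mulr0.
  by apply: inA; exact: theta_space0.
(* Closure is transported from the theta space: both functions are lifts, and lifting is linear. *)
- move=> c p1 p2 /set_mem h1 /set_mem h2; apply: mem_set.
  rewrite -(fK _ h1) -(fK _ h2) -phi_of_linear; apply: inA.
  by apply: theta_space_linear; exact: inT.
- by move=> c f1 f2 _ _; exact: phi_of_linear.
- by move=> f; exact: inA.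
- move=> f1 f2 _ _ f12.
  by rewrite -(phi_ofK S ImOmega f1) f12 phi_ofK.
- move=> phi hphi; exists (f_of S Omega phi); [exact: inT|exact: fK].
- by move=> W; exists (heis_of Omega W); exact: heis_ofK.
- by move=> phi hphi W g; exact: f_of_unique.
- by move=> phi hphi; split; [exact: inT|exact: fK].
- by move=> f _; exact: phi_ofK.
Qed.
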